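(* Let $N\ge 1$ be an integer and let $g:\mathbb{R}\to\mathbb{R}$ satisfy: (g1) $g\in C(\mathbb{R})$; (g2) $g$ is odd; (g3) there exists $\alpha\in(0,+\infty]$ such that $g$ is positive on $(0,\alpha)$ and negative on $(\alpha,+\infty)$; and, if $N\ge 2$, also (g4) $g$ is differentiable in $0$ and $g'(0)>0$. Let $G(t)=\int_0^t g(s)\,ds$. Then, for any $\xi\in\mathbb{R}$ with $|\xi|<\alpha$ and $G(\xi)<1$, there exists an oscillating solution $u_\xi\in C^2(\mathbb{R}^N)$ of $$-\operatorname{div}\left(\frac{\nabla u}{\sqrt{1+|\nabla u|^2}}\right)=g(u)\qquad\text{in }\mathbb{R}^N$$ such that $u_\xi(0)=\xi$ and $\|u_\xi\|_{L^\infty(\mathbb{R}^N)}=|\xi|$. Moreover $u_\xi$ is periodic if $N=1$, while it is localized if $N\ge 2$.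
   Context: A solution of the equation is a function $u\in C^2(\mathbb{R}^N)$ that satisfies the equation pointwise in $\mathbb{R}^N$ (classical solution). A solution $u$ is called oscillating if it has an unbounded sequence of zeros. A solution $u$ is called localized if it converges to zero at infinity together with its partial derivatives up to order 2. If $\alpha=+\infty$, the interval $(\alpha,+\infty)$ in (g3) is empty. *)

(* Defs.v *)
From HB Require Import structures.
From mathcomp Require Import all_boot all_order all_algebra.
From mathcomp Require Import all_classical all_reals all_analysis.

Set Implicit Arguments.
Unset Strict Implicit.
Unset Printing Implicit Defensive.

Import Order.TTheory GRing.Theory Num.Theory.
Import numFieldNormedType.Exports.

Local Open Scope classical_set_scope.
Local Open Scope ring_scope.

Section Calculus.
Context {R : realType} {N : nat}.
Implicit Types (u : 'rV[R]_N -> R) (F : 'rV[R]_N -> 'rV[R]_N).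

(* The library norm `|x| on 'rV[R]_N is the sup norm; the Euclidean norm is
   needed for the length of the gradient. *)
Definition enorm (x : 'rV[R]_N) : R := Num.sqrt (\sum_i x ord0 i ^+ 2).

Definition basis_vec (i : 'I_N) : 'rV[R]_N := delta_mx ord0 i.

Definition partial (i : 'I_N) u : 'rV[R]_N -> R :=
  fun x => 'D_(basis_vec i) u x.

Definition has_partial (i : 'I_N) u : Prop :=
  forall x, derivable u x (basis_vec i).

Definition gradient u : 'rV[R]_N -> 'rV[R]_N :=
  fun x => \row_i partial i u x.

Definition divergence F : 'rV[R]_N -> R :=
  fun x => \sum_i partial i (fun y => F y ord0 i) x.

Definition C2 u : Prop :=
  [/\ continuous u,
      forall i, has_partial i u /\ continuous (partial i u) &
      forall i j, has_partial j (partial i u) /\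
                  continuous (partial j (partial i u))].

Definition classical_solution (g : R -> R) u : Prop :=
  C2 u /\
  forall x, - divergence (fun y =>
      (Num.sqrt (1 + enorm (gradient u y) ^+ 2))^-1 *: gradient u y) x
    = g (u x).

Definition oscillating u : Prop :=
  exists z : nat -> 'rV[R]_N,
    (forall k, u (z k) = 0) /\ ~ bounded_set (range z).

Definition vanishes_at_infinity u : Prop :=
  forall e : R, 0 < e ->
    exists M : R, forall x, M < enorm x -> `|u x| < e.

Definition localized u : Prop :=
  [/\ vanishes_at_infinity u,
      forall i, vanishes_at_infinity (partial i u) &
      forall i j, vanishes_at_infinity (partial j (partial i u))].

Definition is_periodic u : Prop :=
  exists2 T : 'rV[R]_N, T != 0 & periodic u T.

(* The library has no Lebesgue measure on R^N for general N; negligibility only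
   requires the outer measure, defined by countable covers by closed boxes. *)
Definition box (a b : 'rV[R]_N) : set 'rV[R]_N :=
  [set x | forall i, a ord0 i <= x ord0 i <= b ord0 i].

Definition box_volume (a b : 'rV[R]_N) : R :=
  \prod_i (b ord0 i - a ord0 i).

Definition lebesgue_outer_measure (A : set 'rV[R]_N) : \bar R :=
  ereal_inf [set v | exists a b : nat -> 'rV[R]_N,
    [/\ forall k i, a k ord0 i <= b k ord0 i,
        A `<=` \bigcup_k box (a k) (b k) &
        v = (\sum_(0 <= k <oo) (box_volume (a k) (b k))%:E)%E]].

Definition Linfty_norm u : \bar R :=
  ereal_inf [set M | lebesgue_outer_measure [set x | (M < `|u x|%:E)%E] = 0%E].

End Calculus.

Section Nonlinearity.
Context {R : realType}.
Implicit Types (g : R -> R) (alpha : \bar R).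

Definition odd_fun g : Prop := forall s, g (- s) = - g s.

Definition sign_condition g alpha : Prop :=
  [/\ (0 < alpha)%E,
      forall s : R, 0 < s -> (s%:E < alpha)%E -> 0 < g s &
      forall s : R, (alpha < s%:E)%E -> g s < 0].

Definition positive_derivative_at_0 g : Prop :=
  derivable g 0 1 /\ 0 < derive1 g 0.

(* The library integral is over a set, hence the explicit orientation. *)
Definition primitive g (t : R) : R :=
  if 0 <= t then \int[lebesgue_measure]_(s in `[0, t]) g s
  else - \int[lebesgue_measure]_(s in `[t, 0]) g s.

End Nonlinearity.

(* Main.v *)
Require Import Defs.
From mathcomp Require Import all_boot all_order all_algebra.
From mathcomp Require Import all_classical all_reals all_analysis.
From mathcomp Require Import measurable_realfun ring lra.
Import Order.TTheory GRing.Theory Num.Theory.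
Import numFieldNormedType.Exports.
Local Open Scope classical_set_scope.
Local Open Scope ring_scope.
Set Implicit Arguments.
Unset Strict Implicit.
Unset Printing Implicit Defensive.

(* Radial ansatz [u x = v |x|], [r = |x|], [w = v' / sqrt (1 + v'^2)]: the equation becomes
   [v' = w / sqrt (1 - w^2)], [w' + (N - 1) w / r = - g v], [v 0 = xi], [w 0 = 0].  Since [g] is
   only continuous, a solution is obtained by compactness (Peano), after truncating [g] and the
   slope function so that everything is bounded.  The energy [G v + 1 - sqrt (1 - w^2)] is
   nonincreasing; starting from [G xi < 1] it keeps [|v| <= |xi|] and [|w|] away from [1], so
   the truncations are never seen.

   If [N = 1], [v] reaches zero, and reflecting the arc between two opposite zeros gives a periodic
   solution; this avoids any uniqueness statement.  If [N >= 2], then [g s >= k s] on [0, |xi|],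
   so [- w / v] satisfies a Riccati inequality that forbids a constant sign of [v] near infinity,
   and a perturbed energy shows that the energy cannot have a positive limit, because [1 / r] is
   not integrable at infinity. *)

(** * Calculus on the line *)

(** The condition [G xi < 1] enters because [1 - sqrt (1 - w^2)] takes its values in [[0, 1)] for
    [|w| < 1]: an initial energy below 1 is the kinetic energy of some level [a < 1], and [a] is
    where [w] is truncated. The truncated functions keep their sign beyond the truncation levels, so
    their primitives go on growing there, and the energy of the truncated system alone confines [v]
    and [w]. The singular term [w / r] is the reason for working with [q = w / r]. Its limit at the
    origin is [- g xi / N], and this value is exactly what makes the second derivatives of [u]
    continuous there. In dimension one nothing is assumed on [g'(0)], so the first zero cannot come
    from the Riccati inequality; it comes from the fact that [w] decreases as long as [v] is
    positive. Negative [xi] are reached through the oddness of [g]. *)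

Section RealCalculus.
Context {R : realType}.
Implicit Types (f g df : R -> R) (a b c x y r t C : R).

Lemma is_derive_val f x a b : is_derive x (1 : R) f a -> a = b -> is_derive x (1 : R) f b.
Proof. by move=> hf <-. Qed.

Lemma is_derive_const x c : is_derive x (1 : R) (fun=> c) 0.
Proof. exact: is_derive_cst. Qed.

Lemma is_derive_add f g x a b :
  is_derive x (1 : R) f a -> is_derive x (1 : R) g b ->
  is_derive x (1 : R) (fun t => f t + g t) (a + b).
Proof. by move=> hf hg; exact: is_deriveD. Qed.

Lemma is_derive_opp f x a :
  is_derive x (1 : R) f a -> is_derive x (1 : R) (fun t => - f t) (- a).
Proof. by move=> hf; exact: is_deriveN. Qed.

Lemma is_derive_sub f g x a b :
  is_derive x (1 : R) f a -> is_derive x (1 : R) g b ->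
  is_derive x (1 : R) (fun t => f t - g t) (a - b).
Proof. by move=> hf hg; exact: is_deriveB. Qed.

Lemma is_derive_mul f g x a b :
  is_derive x (1 : R) f a -> is_derive x (1 : R) g b ->
  is_derive x (1 : R) (fun t => f t * g t) (a * g x + f x * b).
Proof.
move=> hf hg; apply: (is_derive_eq (is_deriveM hf hg)).
by rewrite /GRing.scale /= addrC; congr (_ + _); rewrite mulrC.
Qed.

Lemma is_derive_scale f x (c a : R) :
  is_derive x (1 : R) f a -> is_derive x (1 : R) (fun t => c * f t) (c * a).
Proof. by move=> hf; exact: is_deriveZ. Qed.

Lemma is_derive_pow x n : is_derive x (1 : R) (fun t : R => t ^+ n) (n%:R * x ^+ n.-1).
Proof.
by apply: DeriveDef; [exact: exprn_derivable|rewrite exp_derive /GRing.scale /= mulr1 mulr_natl].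
Qed.

Lemma is_derive_inv f x a : f x != 0 ->
  is_derive x (1 : R) f a -> is_derive x (1 : R) (fun t => (f t)^-1) (- a / f x ^+ 2).
Proof.
move=> fx0 hf; apply: (is_derive_eq (is_deriveV fx0 hf)).
by rewrite /GRing.scale /= mulNr mulrC mulNr.
Qed.

Lemma is_derive_comp1 f g x a b :
  is_derive (g x) (1 : R) f a -> is_derive x (1 : R) g b ->
  is_derive x (1 : R) (fun t => f (g t)) (a * b).
Proof. by move=> hf hg; exact: is_derive1_comp. Qed.

Lemma is_derive_near_eq f g x a : (\near x, f x = g x) ->
  is_derive x (1 : R) g a -> is_derive x (1 : R) f a.
Proof.
by move=> fg; apply: near_eq_is_derive; apply: filterS fg => y ->.
Qed.

Lemma is_derive_continuous f x a : is_derive x (1 : R) f a -> {for x, continuous f}.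
Proof.
by move=> hf; apply/differentiable_continuous/derivable1_diffP; exact: ex_derive.
Qed.

(** Differentiability is asked only inside the interval, since the radial system is singular at
    [r = 0] and only continuity is at hand there. *)
Lemma mean_value f df a b : a < b ->
  (forall x, a < x < b -> is_derive x (1 : R) f (df x)) ->
  (forall x, a <= x <= b -> {for x, continuous f}) ->
  exists2 c : R, a < c < b & f b - f a = df c * (b - a).
Proof.
move=> ab hf cf; have hf' x : x \in `]a, b[ -> is_derive x (1 : R) f (df x).
  by rewrite in_itv /=; exact: hf.
have [|c] := MVT ab hf'.
- by apply: continuous_in_subspaceT => x; rewrite inE /= in_itv /=; exact: cf.
- by rewrite in_itv /= => cab ->; exists c.
Qed.

Lemma le_of_derive_ge0 f df a b : a <= b ->
  (forall x, a < x < b -> is_derive x (1 : R) f (df x)) ->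
  (forall x, a <= x <= b -> {for x, continuous f}) ->
  (forall x, a < x < b -> 0 <= df x) -> f a <= f b.
Proof.
rewrite le_eqVlt => /predU1P[-> //|ab] hf cf df0.
have [c cab e] := mean_value ab hf cf.
by rewrite -subr_ge0 e mulr_ge0 ?df0 // subr_ge0 ltW.
Qed.

Lemma ge_of_derive_le0 f df a b : a <= b ->
  (forall x, a < x < b -> is_derive x (1 : R) f (df x)) ->
  (forall x, a <= x <= b -> {for x, continuous f}) ->
  (forall x, a < x < b -> df x <= 0) -> f b <= f a.
Proof.
move=> ab hf cf df0; rewrite -lerN2.
apply: (@le_of_derive_ge0 (fun x => - f x) (fun x => - df x)) => // x xab.
- by apply: is_derive_opp; exact: hf.
- by apply: continuousN; exact: cf.
- by rewrite oppr_ge0 df0.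
Qed.

Lemma nondecreasing_of_derive f df a b : a <= b ->
  (forall x, a <= x <= b -> is_derive x (1 : R) f (df x)) ->
  (forall x, a <= x <= b -> 0 <= df x) -> f a <= f b.
Proof.
move=> ab hf df0; have lt_le x : a < x < b -> a <= x <= b.
  by move=> /andP[ax xb]; rewrite !ltW.
apply: (le_of_derive_ge0 ab (fun x hx => hf x (lt_le x hx))) => x hx.
- exact: is_derive_continuous (hf x hx).
- exact: df0 (lt_le x hx).
Qed.

Lemma nonincreasing_of_derive f df a b : a <= b ->
  (forall x, a <= x <= b -> is_derive x (1 : R) f (df x)) ->
  (forall x, a <= x <= b -> df x <= 0) -> f b <= f a.
Proof.
move=> ab hf df0; have lt_le x : a < x < b -> a <= x <= b.
  by move=> /andP[ax xb]; rewrite !ltW.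
apply: (ge_of_derive_le0 ab (fun x hx => hf x (lt_le x hx))) => x hx.
- exact: is_derive_continuous (hf x hx).
- exact: df0 (lt_le x hx).
Qed.

Lemma neq_nearby (r : R) : r != 0 -> \forall t \near r, t != 0.
Proof. by move=> r0; apply: (@cvgr_neq0 R R R (nbhs r) _ id r). Qed.

Lemma continuous_itv_integrable f a b : continuous f ->
  (@lebesgue_measure R).-integrable `[a, b] (EFin \o f).
Proof.
by move=> cf; apply: continuous_compact_integrable;
  [exact: segment_compact|exact: continuous_subspaceT].
Qed.

(** A base point to the left of both 0 and [t] removes the case distinction on the sign of [t], so
    the fundamental theorem of calculus also covers [t = 0]. *)
Lemma primitive_shift f a t : continuous f -> a < 0 -> a < t ->
  primitive f t = \int[lebesgue_measure]_(s in `[a, t]) f s -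
                  \int[lebesgue_measure]_(s in `[a, 0]) f s.
Proof.
move=> cf a0 at_; rewrite /primitive; case: ifPn => [t0|].
  rewrite Rintegral_itvB ?Rintegral_itv_obnd_cbnd ?bnd_simp ?(ltW a0) //.
  - by apply: integrableS (continuous_itv_integrable 0 t cf) => //;
      apply: subset_itvr; rewrite bnd_simp.
  - exact: continuous_itv_integrable.
rewrite -ltNge => t0; rewrite -[RHS]opprB; congr (- _).
rewrite Rintegral_itvB ?Rintegral_itv_obnd_cbnd ?bnd_simp ?(ltW at_) ?(ltW t0) //.
- by apply: integrableS (continuous_itv_integrable t 0 cf) => //;
    apply: subset_itvr; rewrite bnd_simp.
- exact: continuous_itv_integrable.
Qed.

Lemma is_derive_primitive f t : continuous f -> is_derive t (1 : R) (primitive f) (f t).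
Proof.
move=> cf; pose a := Num.min t 0 - 1.
have at_ : a < t by rewrite /a ltrBlDr (@le_lt_trans _ _ t) ?ge_min ?lexx // ltrDl.
have a0 : a < 0 by rewrite /a ltrBlDr (@le_lt_trans _ _ 0) ?ge_min ?lexx ?orbT // ltrDl.
apply: (@is_derive_near_eq _ (fun y =>
  \int[lebesgue_measure]_(s in `[a, y]) f s - \int[lebesgue_measure]_(s in `[a, 0]) f s)).
  near=> y; apply: primitive_shift => //; near: y.
  exact: lt_nbhsr.
have [D DE] := @continuous_FTC1_closed R f a t (t + 1) ltac:(by rewrite ltrDl)
  (continuous_itv_integrable a (t + 1) cf) at_ (cf t).
rewrite -[f t]subr0; apply: (is_derive_sub _ (is_derive_const _ _)).
by apply: DeriveDef => //; rewrite -DE derive1E.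
Unshelve. all: by end_near. Qed.

Lemma primitive0 f : primitive f 0 = 0.
Proof. by rewrite /primitive lexx set_itv1 Rintegral_set1. Qed.

Lemma primitive_continuous f : continuous f -> continuous (primitive f).
Proof. by move=> cf t; apply: is_derive_continuous; exact: is_derive_primitive. Qed.

Lemma primitive_even f t : continuous f -> odd_fun f -> primitive f (- t) = primitive f t.
Proof.
move=> cf of_; apply/eqP; rewrite -subr_eq0; apply/eqP.
suff h s : is_derive s (1 : R) (fun s => primitive f (- s) - primitive f s) 0.
  by have := is_derive_0_is_cst t 0 h; rewrite oppr0 subrr.
apply: (@is_derive_val _ _ (f (- s) * - 1 - f s)); last by rewrite of_; ring.
apply: (is_derive_sub _ (is_derive_primitive _ cf)).
exact: (is_derive_comp1 (is_derive_primitive _ cf) (is_derive_opp (is_derive_id _ _))).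
Qed.

Lemma eq_primitive f g r : 0 <= r -> (forall t, 0 <= t <= r -> f t = g t) ->
  primitive f r = primitive g r.
Proof.
move=> r0 fg; rewrite /primitive r0; apply: eq_Rintegral => t.
by rewrite inE /= in_itv /=; exact: fg.
Qed.

Lemma primitive_dominated (f_ : nat -> R -> R) f C r : 0 <= r ->
  (forall n, continuous (f_ n)) -> continuous f ->
  (forall n t, 0 <= t <= r -> `|f_ n t| <= C) ->
  (forall t, 0 <= t <= r -> f_ n t @[n --> \oo] --> f t) ->
  primitive (f_ n) r @[n --> \oo] --> primitive f r.
Proof.
move=> r0 cf_ cf fC f_f; rewrite /primitive r0.
have i_ n := continuous_itv_integrable 0 r (cf_ n).
have i := continuous_itv_integrable 0 r cf.
have [|||||_ _] := @dominated_convergence _ _ _ (@lebesgue_measure R)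
  `[0, r]%classic (measurable_itv _) (fun n => EFin \o f_ n) (EFin \o f) (fun=> C%:E).
- by move=> n; case/integrableP: (i_ n).
- by case/integrableP: i.
- by apply: aeW => t /=; rewrite in_itv /= => tr; apply: cvg_EFin; [exact: nearW|exact: f_f].
- have := @continuous_itv_integrable (cst C) 0 r; apply.
  exact: cst_continuous.
- by apply: aeW => t /= n; rewrite in_itv /= lee_fin => tr; exact: fC.
move=> h; apply: fine_cvg => /=.
rewrite [X in _ --> X]fineK; first exact: h.
exact: integrable_fin_num.
Qed.

End RealCalculus.

(** * Peano's theorem for the radial system *)

Section Peano.
Context {R : realType}.
Implicit Types (f v h : R -> R) (a b c x y r s t L M : R).

Definition lipschitz_fun L f := forall s t, `|f s - f t| <= L * `|s - t|.

Lemma lipschitz_fun_continuous L f : 0 <= L -> lipschitz_fun L f -> continuous f.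
Proof.
move=> L0 Lf x; apply/cvgrPdist_le => e e0; near=> y.
apply: (le_trans (Lf _ _)); rewrite (@le_trans _ _ ((L + 1) * `|x - y|)) //.
  by rewrite ler_wpM2r // lerDl.
rewrite mulrC -ler_pdivlMr ?ltr_wpDl //; near: y.
by apply: cvgr_dist_le; [exact: cvg_id|rewrite divr_gt0 // ltr_wpDl].
Unshelve. all: by end_near. Qed.

(** For each [t] the values [f_ n t] stay in a compact segment around [c], so they converge along an
    ultrafilter, for all [t] at once. This takes the place of the diagonal argument in
    Arzela-Ascoli. *)
Lemma lipschitz_ultra_limit (U : set_system nat) L c (f_ : nat -> R -> R) :
  UltraFilter U -> (forall n, lipschitz_fun L (f_ n)) -> (forall n, f_ n 0 = c) ->
  exists f, (forall t, f_ n t @[n --> U] --> f t) /\ lipschitz_fun L f.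
Proof.
move=> UU Lf f0.
have [f hf] : {f : R -> R & forall t, f_ n t @[n --> U] --> f t}.
  apply: (@choice _ _ (fun t p => f_ n t @[n --> U] --> p)) => t.
  have [|p [_ clp]] := @segment_compact R (c - L * `|t|) (c + L * `|t|) (f_^~ t @ U) _.
    apply: (@filterE _ U) => k /=; rewrite in_itv /= -ler_distlC -(f0 k).
    by have := Lf k 0 t; rewrite sub0r normrN.
  exists p => B Bp; case: (in_ultra_setVsetC (f_^~ t @^-1` B) UU) => // UnB.
  by have [x []] := clp (~` B) B UnB Bp.
exists f; split => // s t.
have c1 : `|f_ n s - f_ n t| @[n --> U] --> `|f s - f t|.
  by apply: cvg_norm; apply: cvgB; exact: hf.
have c2 : L * `|s - t| @[n --> U] --> L * `|s - t| by exact: cvg_cst.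
by apply: (ler_cvg_to c1 c2); apply: nearW => k; exact: Lf.
Qed.

(** Dominated convergence is about sequences, so a sequence is extracted from the ultrafilter limit
    [f]: [sg m >= m] is an index at which [f_] is within [1 / m.+1] of [f] at the first [m.+1]
    rationals. The common Lipschitz constant carries the convergence from the rationals to every
    [t]. *)
Lemma lipschitz_subsequence L c (f_ : nat -> R -> R) : 0 <= L ->
  (forall n, lipschitz_fun L (f_ n)) -> (forall n, f_ n 0 = c) ->
  exists (sg : nat -> nat) f, [/\ forall m, (m <= sg m)%N, lipschitz_fun L f &
    forall t, f_ (sg m) t @[m --> \oo] --> f t].
Proof.
move=> L0 Lf f0; have [U [UU ooU]] := ultraFilterLemma eventually_filter.
have [f [hf Lf']] := lipschitz_ultra_limit UU Lf f0.
(* Enumeration of the rationals; integers that encode no rational give 0, which is harmless. *)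
pose q k : R := if @unpickle rat k is Some z then ratr z else 0.
have [sg hsg] : {sg : nat -> nat & forall m, (m <= sg m)%N /\
    forall k : 'I_m.+1, `|f (q k) - f_ (sg m) (q k)| < m.+1%:R^-1}.
  apply: (@choice _ _ (fun m n => (m <= n)%N /\
    forall k : 'I_m.+1, `|f (q k) - f_ n (q k)| < m.+1%:R^-1)) => m.
  apply: (@filter_ex _ U); apply: filterI.
    by apply: ooU; exact: nbhs_infty_ge.
  apply: filter_forall => k; move: (hf (q k)) => /cvgrPdist_lt; apply.
  by rewrite invr_gt0.
exists sg, f; split => [m||t] //; first by have [] := hsg m.
apply/cvgrPdist_le => /= e e0.
have e4 : 0 < e / 4 by rewrite divr_gt0.
have L1 : 0 < L + 1 by rewrite ltr_wpDl.
have [d d0 Ld] : exists2 d : R, 0 < d & L * d <= e / 4.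
  exists (e / 4 / (L + 1)); first by rewrite divr_gt0.
  by rewrite mulrCA ger_pMr // ler_pdivrMr // mul1r lerDl.
have [z] : exists z : rat, ratr z \in `]t, t + d[ by apply: rat_in_itvoo; rewrite ltrDl.
rewrite in_itv /= => /andP[tz ztd].
have tzd : `|t - ratr z| <= d by rewrite ler_distlC; apply/andP; split; lra.
near=> m.
have qz : q (pickle z) = ratr z by rewrite /q pickleK.
have km : (pickle z < m.+1)%N by rewrite ltnS; near: m; exact: nbhs_infty_ge.
have [_ /(_ (Ordinal km))] := hsg m; rewrite /= qz => h1.
have h2 : m.+1%:R^-1 <= e / 4 by apply: ltW; near: m; exact: (near_infty_natSinv_lt (PosNum e4)).
have h3 := le_trans (Lf' t (ratr z)) (ler_wpM2l L0 tzd).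
have h4 := le_trans (Lf (sg m) t (ratr z)) (ler_wpM2l L0 tzd).
move: (L * d) (m.+1%:R^-1) Ld h2 h1 h3 h4 => Q Q' Ld h2.
rewrite ltr_distl !ler_distl => /andP[? ?] /andP[? ?] /andP[? ?].
apply/andP; split; lra.
Unshelve. all: by end_near. Qed.

Variables (n : nat) (h p : R -> R) (M xi : R).
Hypotheses (ch : continuous h) (cp : continuous p).
Hypotheses (hM : forall s, `|h s| <= M) (pM : forall s, `|p s| <= M).

Lemma flux_integrand_continuous v : continuous v -> continuous (fun t => t ^+ n * h (v t)).
Proof.
move=> cv t; apply: cvgM; first exact: exprn_continuous.
by apply: continuous_comp; [exact: cv|exact: ch].
Qed.

(* At [r = 0] the value is [0]: the numerator vanishes if [n = 0], and [0^-1 = 0] otherwise. *)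
Definition flux v r := - primitive (fun t => t ^+ n * h (v t)) `|r| / `|r| ^+ n.

Lemma flux0 v : flux v 0 = 0.
Proof. by rewrite /flux normr0 primitive0 oppr0 mul0r. Qed.

(** By the mean value theorem the flux at [r > 0] is [- h (v c) * (c / r)^n * r] with [0 < c < r].
    The linear bound yields continuity at the singular point 0. *)
Lemma flux_bound v r : continuous v -> `|flux v r| <= M * `|r|.
Proof.
move=> cv; have [->|r0] := eqVneq r 0; first by rewrite flux0 !normr0 mulr0.
have rp : 0 < `|r| by rewrite normr_gt0.
have ci := flux_integrand_continuous cv.
have [||c /andP[c0 cr] ] := mean_value (f := primitive (fun t => t ^+ n * h (v t)))
  (df := fun t => t ^+ n * h (v t)) rp.
- by move=> x _; exact: is_derive_primitive.
- by move=> x _; exact: primitive_continuous.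
rewrite primitive0 !subr0 /flux => ->.
rewrite normrM normrN normfV normrX normr_id ler_pdivrMr ?exprn_gt0 //.
rewrite !normrM normr_id normrX (ger0_norm (ltW c0)).
rewrite [leRHS]mulrAC ler_wpM2r // mulrC ler_pM // ?exprn_ge0 //.
  exact: ltW.
by rewrite lerXn2r ?nnegrE ?ltW.
Qed.

Lemma flux_continuous v : continuous v -> continuous (flux v).
Proof.
move=> cv r; have [->|r0] := eqVneq r 0.
  have M0 : 0 <= M by exact: le_trans (pM 0).
  apply/cvgrPdist_le => e e0; near=> y; rewrite flux0 sub0r normrN.
  apply: (le_trans (flux_bound y cv)).
  rewrite (@le_trans _ _ ((M + 1) * `|y|)) ?ler_wpM2r ?lerDl //.
  rewrite mulrC -ler_pdivlMr ?ltr_wpDl //; near: y.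
  by apply: cvgr0_norm_le; [exact: cvg_id|rewrite divr_gt0 // ltr_wpDl].
have cn : {for r, continuous (fun x : R => `|x| ^+ n)}.
  apply: (@continuous_comp _ _ _ (fun x : R => `|x|) (fun x : R => x ^+ n)).
    exact: norm_continuous.
  exact: exprn_continuous.
apply: cvgM; last by apply: cvgV cn; rewrite expf_neq0 // normr_eq0.
apply: cvgN; apply: continuous_comp; first exact: norm_continuous.
by apply: primitive_continuous; exact: flux_integrand_continuous.
Unshelve. all: by end_near. Qed.

Lemma eq_flux v1 v2 r : 0 <= r -> (forall t, 0 <= t <= r -> v1 t = v2 t) ->
  flux v1 r = flux v2 r.
Proof.
move=> r0 v12; rewrite /flux ger0_norm //; congr (- _ / _).
by apply: eq_primitive => // t tr; rewrite v12.
Qed.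

(** Integral form of the system with [w] eliminated: for given [v], the equation
    [(r^n w)' = - r^n h v] integrates to [w = flux v], and a fixed point then satisfies
    [v' = p w]. *)
Definition picard v r := xi + primitive (p \o flux v) r.

Lemma picard_integrand_continuous v : continuous v -> continuous (p \o flux v).
Proof.
by move=> cv t; apply: continuous_comp; [exact: flux_continuous|exact: cp].
Qed.

Lemma is_derive_picard v r : continuous v ->
  is_derive r (1 : R) (picard v) (p (flux v r)).
Proof.
move=> cv; rewrite -[p _]add0r; apply: (is_derive_add (is_derive_const _ _)).
by apply: is_derive_primitive; exact: picard_integrand_continuous.
Qed.

Lemma picard_lipschitz v : continuous v -> lipschitz_fun M (picard v).
Proof.
move=> cv; suff H s t : s < t -> `|picard v s - picard v t| <= M * `|s - t|.
  by move=> s t; case: (ltgtP s t) => [/H //|/H|->];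
    rewrite ?subrr ?normr0 ?mulr0 // distrC [`|t - s|]distrC.
move=> st; have [||c _] := mean_value (f := picard v) (df := p \o flux v) st.
- by move=> x _; exact: is_derive_picard.
- by move=> x _; apply: is_derive_continuous; exact: is_derive_picard.
by rewrite distrC [`|s - t|]distrC => ->; rewrite normrM ler_wpM2r //; exact: pM.
Qed.

Lemma picard0 v : picard v 0 = xi.
Proof. by rewrite /picard primitive0 addr0. Qed.

(* Delaying the argument by [e] makes the iterates stationary: the [k]-th one solves the delayed
   equation exactly up to time [k * e]. *)
Definition delayed e k := iter k (fun v r => picard v (Num.max (r - e) 0)) (fun=> xi).

Lemma delayed_lipschitz e k : lipschitz_fun M (delayed e k).
Proof.
have M0 : 0 <= M by exact: le_trans (pM 0).
elim: k => [s t|k IH s t] /=; first by rewrite subrr normr0 mulr_ge0.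
apply: (le_trans (picard_lipschitz (lipschitz_fun_continuous M0 IH) _ _)).
rewrite ler_wpM2l // !maxEle; have := ler_norm (s - t); have := ler_norm (t - s).
rewrite [`|t - s|]distrC => h1 h2.
by case: ifPn => ?; case: ifPn => ?; rewrite ler_norml; apply/andP; split; lra.
Qed.

Lemma delayed_continuous e k : continuous (delayed e k).
Proof.
by apply: (@lipschitz_fun_continuous M); [exact: le_trans (pM 0)|exact: delayed_lipschitz].
Qed.

Lemma delayed0 e k : 0 <= e -> delayed e k 0 = xi.
Proof. by move=> e0; case: k => [//|k] /=; rewrite sub0r max_r ?oppr_le0 // picard0. Qed.

(** The value of an iterate at [r] depends on the previous iterate only up to time [r - e], so each
    iteration extends the interval of agreement by [e]. *)
Lemma delayed_stationary e k r : 0 <= e -> r <= k%:R * e ->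
  delayed e k.+1 r = delayed e k r.
Proof.
move=> e0; elim: k r => [r|k IH r].
  by rewrite mul0r => r0 /=; rewrite max_r ?picard0 // subr_le0 (le_trans r0).
rewrite -natr1 mulrDl mul1r => rk; rewrite [LHS]/= [RHS]/= /picard; congr (_ + _).
have r0 : 0 <= Num.max (r - e) 0 by rewrite le_max lexx orbT.
have rk' : Num.max (r - e) 0 <= k%:R * e by rewrite ge_max mulr_ge0 // lerBlDr rk.
apply: eq_primitive => // t /andP[t0 tr] /=; congr p; apply: eq_flux => // s /andP[s0 st].
by apply: IH; rewrite (le_trans st) // (le_trans tr).
Qed.

Lemma delayed_picard e k r : 0 <= e -> 0 <= r <= k%:R * e ->
  `|delayed e k r - picard (delayed e k) r| <= M * e.
Proof.
move=> e0 /andP[r0 rk]; rewrite -delayed_stationary //=.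
have M0 : 0 <= M by exact: le_trans (pM 0).
apply: (le_trans (picard_lipschitz (@delayed_continuous _ _) _ _)).
rewrite ler_wpM2l // maxEle; case: ifPn; rewrite ?subr_le0 -?ltNge => ?;
  rewrite ler_norml; apply/andP; split; lra.
Qed.

Theorem peano : exists v, [/\ continuous v, v 0 = xi &
  forall r, 0 <= r -> v r = picard v r].
Proof.
have M0 : 0 <= M by exact: le_trans (pM 0).
(* With delay [1 / m.+1], [m.+1 * m.+1] iterations are stationary up to time [m.+1], so every fixed
   [r] is eventually covered, with an error of at most [M / m.+1]. *)
pose w m := delayed m.+1%:R^-1 (m.+1 * m.+1).
have [|m|sg [v [sgm Lv wv]]] := @lipschitz_subsequence M xi w M0.
- by move=> m; exact: delayed_lipschitz.
- by apply: delayed0; rewrite invr_ge0.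
have cw m : continuous (w m) by exact: delayed_continuous.
have cv := lipschitz_fun_continuous M0 Lv.
exists v; split => // [|r r0].
  apply: (@cvg_unique _ _ (w (sg m) 0 @[m --> \oo])) => //; first exact: wv.
  rewrite (_ : (fun m => _) = fun=> xi); first exact: cvg_cst.
  by apply/funext => m; rewrite /w delayed0 // invr_ge0.
have Fw t : 0 <= t -> flux (w (sg m)) t @[m --> \oo] --> flux v t.
  move=> t0; rewrite /flux; apply: cvgMl; apply: cvgN; rewrite ger0_norm //.
  apply: (primitive_dominated (C := t ^+ n * M)) => // [m||m s /andP[s0 st]|s _].
  - exact: flux_integrand_continuous.
  - exact: flux_integrand_continuous.
  - rewrite normrM ler_pM // normrX ger0_norm // lerXn2r // ?nnegrE //.
  - apply: cvgMr; apply: continuous_cvg; [exact: ch|exact: wv].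
have Pw : picard (w (sg m)) r @[m --> \oo] --> picard v r.
  rewrite /picard; apply: cvgD; first exact: cvg_cst.
  apply: (primitive_dominated (C := M)) => // [m||m s _|s /andP[s0 _]].
  - exact: picard_integrand_continuous.
  - exact: picard_integrand_continuous.
  - exact: pM.
  - by apply: continuous_cvg; [exact: cp|exact: Fw].
apply/eqP; rewrite -subr_eq0 -normr_le0.
have c1 : `|w (sg m) r - picard (w (sg m)) r| @[m --> \oo] --> `|v r - picard v r|.
  by apply: cvg_norm; apply: cvgB; [exact: wv|exact: Pw].
have c2 : M * m.+1%:R^-1 @[m --> \oo] --> 0.
  by rewrite -[X in _ --> X](mulr0 M); apply: cvgMr; exact: cvg_harmonic.
apply: (ler_cvg_to c1 c2).
near=> m; apply: (@le_trans _ _ (M * (sg m).+1%:R^-1)).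
  apply: delayed_picard; first by rewrite invr_ge0.
  rewrite r0 natrM mulfK ?pnatr_eq0 //=.
  apply: (@le_trans _ _ m%:R); first by near: m; exact: nbhs_infty_ger.
  by rewrite ler_nat leqW.
by rewrite ler_wpM2l // lef_pV2 ?posrE // ler_nat ltnS.
Unshelve. all: by end_near. Qed.

End Peano.

(** * Truncation *)

Section Clamp.
Context {R : realType}.
Implicit Types (f : R -> R) (a x : R).

Definition clamp a x := Num.max (- a) (Num.min x a).

Lemma clamp_continuous a : continuous (clamp a).
Proof.
have e : clamp a = (cst (- a) : R -> R) \max (idfun \min (cst a)) by [].
rewrite e => x.
apply: continuous_max; first exact: cst_continuous.
by apply: continuous_min; [exact: cvg_id|exact: cst_continuous].
Qed.

Lemma clamp_id a x : `|x| <= a -> clamp a x = x.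
Proof.
by rewrite ler_norml => /andP[ax xa]; rewrite /clamp min_l // max_r.
Qed.

Lemma clamp_opp a x : 0 <= a -> clamp a (- x) = - clamp a x.
Proof.
move=> a0; rewrite /clamp; have [h1|h1] := lerP (- x) a; have [h2|h2] := lerP x a.
all: have [h3|h3] := lerP (- a) (- x); have [h4|h4] := lerP (- a) x;
  have [h5|h5] := lerP (- a) a; lra.
Qed.

Lemma clamp_norm a x : 0 <= a -> `|clamp a x| <= a.
Proof.
move=> a0; rewrite ler_norml /clamp le_max ge_max ge_min !lexx /= orbT andbT; lra.
Qed.

Variables (f : R -> R) (a : R).
Hypotheses (a0 : 0 < a) (cf : forall x, `|x| <= a -> {for x, continuous f}).

Lemma clamped_continuous : continuous (f \o clamp a).
Proof.
move=> x; apply: continuous_comp; first exact: clamp_continuous.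
by apply: cf; rewrite clamp_norm // ltW.
Qed.

Lemma clamped_bounded : exists M : R, forall x, `|f (clamp a x)| <= M.
Proof.
have [||c _ hc] := @EVT_max R (fun x => `|f (clamp a x)|) (- a) a; first by rewrite ge0_cp // ltW.
  apply: continuous_subspaceT => x.
  by apply: cvg_norm; exact: clamped_continuous.
exists `|f (clamp a c)| => x.
have xa := clamp_norm x (ltW a0); rewrite -(clamp_id xa) hc //.
by rewrite in_itv /= -ler_norml.
Qed.

Hypotheses (oddf : odd_fun f) (fpos : forall x, 0 < x <= a -> 0 < f x).
Local Notation F := (primitive (f \o clamp a)).

Lemma clamped_odd : odd_fun (f \o clamp a).
Proof. by move=> x /=; rewrite clamp_opp ?oddf // ltW. Qed.

Lemma clamped_gt0 x : 0 < x -> 0 < f (clamp a x).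
Proof.
move=> x0; apply: fpos; have := clamp_norm x (ltW a0).
rewrite ler_norml => /andP[_ ->]; rewrite andbT /clamp lt_max lt_min x0 a0.
by rewrite orbT.
Qed.

Lemma clamped_primitive_ge0 x : 0 <= F x.
Proof.
wlog x0 : x / 0 <= x.
  move=> H; have [/H //|x0] := lerP 0 x.
  rewrite -(primitive_even x clamped_continuous clamped_odd).
  by apply: H; rewrite oppr_ge0 ltW.
rewrite -(primitive0 (f \o clamp a)).
apply: (le_of_derive_ge0 (df := f \o clamp a)) => // y.
- by move=> _; apply: is_derive_primitive; exact: clamped_continuous.
- by move=> _; apply: primitive_continuous; exact: clamped_continuous.
- by move=> /andP[y0 _]; rewrite ltW // clamped_gt0.
Qed.

(** Beyond [a] the clamped function keeps the positive value [f a], so its even primitive still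
    increases strictly. An energy level not exceeding [F a] therefore confines [x]; this serves [g]
    with level [xi] as well as [slope] with level [a < 1]. *)
Lemma clamped_primitive_inv x : F x <= F a -> `|x| <= a.
Proof.
wlog x0 : x / 0 <= x.
  move=> H; have [/H //|x0] := lerP 0 x.
  rewrite -(primitive_even x clamped_continuous clamped_odd) -(normrN x).
  by apply: H; rewrite oppr_ge0 ltW.
move=> Fx; rewrite ger0_norm // leNgt; apply/negP => ax; move: Fx; apply/negP; rewrite -ltNge.
have [||c /andP[ac _] e] := mean_value (f := F) (df := f \o clamp a) ax.
- by move=> y _; apply: is_derive_primitive; exact: clamped_continuous.
- by move=> y _; apply: primitive_continuous; exact: clamped_continuous.
by rewrite -subr_gt0 e mulr_gt0 ?subr_gt0 // clamped_gt0 // (lt_trans a0).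
Qed.

Lemma clamped_primitiveE : F a = primitive f a.
Proof.
apply: eq_primitive; first exact: ltW.
by move=> t /andP[t0 ta] /=; rewrite clamp_id // ger0_norm.
Qed.

End Clamp.

(** * Slope and kinetic energy as functions of the flux *)

Section CurvatureFlux.
Context {R : realType}.
Implicit Types (w x a : R).

(* The slope [v'] as a function of [w = v' / sqrt (1 + v'^2)]. *)
Definition slope w := w / Num.sqrt (1 - w ^+ 2).

(* The kinetic part [1 - 1 / sqrt (1 + v'^2)] of the energy as a function of [w]. *)
Definition kinetic w := 1 - Num.sqrt (1 - w ^+ 2).

Lemma slope_odd : odd_fun slope.
Proof. by move=> w; rewrite /slope sqrrN mulNr. Qed.

Lemma one_sub_sqr_gt0 w : `|w| < 1 -> 0 < 1 - w ^+ 2.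
Proof. by rewrite ltr_norml => /andP[? ?]; nra. Qed.

Lemma is_derive_one_sub_sqr w : is_derive w (1 : R) (fun x => 1 - x ^+ 2) (- (2 * w)).
Proof.
apply: (is_derive_val (is_derive_sub (is_derive_const _ _) (is_derive_pow _ _))).
by rewrite expr1; ring.
Qed.

Lemma is_derive_kinetic w : `|w| < 1 -> is_derive w (1 : R) kinetic (slope w).
Proof.
move=> w1; have h := one_sub_sqr_gt0 w1.
have s0 : 0 < Num.sqrt (1 - w ^+ 2) by rewrite sqrtr_gt0.
apply: (is_derive_val (is_derive_sub (is_derive_const _ _)
  (is_derive_comp1 (f := Num.sqrt) (g := fun x => 1 - x ^+ 2) (is_derive1_sqrt h) (is_derive_one_sub_sqr w)))).
rewrite /slope; field; exact: lt0r_neq0.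
Qed.

Lemma slope_continuous w : `|w| < 1 -> {for w, continuous slope}.
Proof.
move=> w1; have h := one_sub_sqr_gt0 w1.
apply: cvgM; first exact: cvg_id.
apply: cvgV; first by rewrite gt_eqF // sqrtr_gt0.
apply: (@continuous_comp _ _ _ (fun x : R => 1 - x ^+ 2) Num.sqrt).
  exact: (is_derive_continuous (is_derive_one_sub_sqr w)).
exact: sqrt_continuous.
Qed.

Lemma slope_gt0 w : 0 < w < 1 -> 0 < slope w.
Proof.
move=> /andP[w0 w1]; rewrite divr_gt0 // sqrtr_gt0 one_sub_sqr_gt0 //.
by rewrite ger0_norm // ltW.
Qed.

Lemma mul_slope_ge w : `|w| < 1 -> w ^+ 2 <= w * slope w.
Proof.
move=> w1; have h := one_sub_sqr_gt0 w1.
have s0 : 0 < Num.sqrt (1 - w ^+ 2) by rewrite sqrtr_gt0.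
rewrite /slope mulrA -expr2 ler_pdivlMr // ler_piMr ?sqr_ge0 //.
by rewrite -[leRHS]sqrtr1 ler_wsqrtr // gerBl sqr_ge0.
Qed.

(** With [s = sqrt (1 - w^2)] this is [(1 - s) s <= (1 - s) (1 + s)]. *)
Lemma kinetic_le_mul_slope w : `|w| < 1 -> kinetic w <= w * slope w.
Proof.
move=> w1; have h := one_sub_sqr_gt0 w1.
have s0 : 0 < Num.sqrt (1 - w ^+ 2) by rewrite sqrtr_gt0.
have s1 : Num.sqrt (1 - w ^+ 2) <= 1.
  by rewrite -[leRHS]sqrtr1 ler_wsqrtr // gerBl sqr_ge0.
have ss := sqr_sqrtr (ltW h).
rewrite /slope /kinetic mulrA -expr2 ler_pdivlMr //; nra.
Qed.

(** With [s = sqrt (1 - w^2)] this is [(1 - s)^2 >= 0]. *)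
Lemma kinetic_ge w : `|w| < 1 -> w ^+ 2 / 2 <= kinetic w.
Proof.
move=> w1; have h := one_sub_sqr_gt0 w1.
have s0 : 0 < Num.sqrt (1 - w ^+ 2) by rewrite sqrtr_gt0.
have s1 : Num.sqrt (1 - w ^+ 2) <= 1.
  by rewrite -[leRHS]sqrtr1 ler_wsqrtr // gerBl sqr_ge0.
have ss := sqr_sqrtr (ltW h).
rewrite /kinetic; nra.
Qed.

Lemma primitive_clamped_slope a : 0 < a < 1 ->
  primitive (slope \o clamp a) a = kinetic a.
Proof.
move=> /andP[a0 a1].
have cs x : `|x| <= a -> {for x, continuous slope}.
  by move=> xa; apply: slope_continuous; rewrite (le_lt_trans xa).
have D x : 0 <= x <= a -> is_derive x (1 : R)
    (fun y => primitive (slope \o clamp a) y - kinetic y) 0.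
  move=> /andP[x0 xa]; have nx : `|x| <= a by rewrite ger0_norm.
  apply: (is_derive_val (is_derive_sub (is_derive_primitive _ (clamped_continuous a0 cs))
    (is_derive_kinetic (le_lt_trans nx a1)))).
  by rewrite /= clamp_id // subrr.
have [||c _] := mean_value (f := fun y => primitive (slope \o clamp a) y - kinetic y)
  (df := fun=> 0) a0.
- by move=> x /andP[x0 xa]; apply: D; rewrite !ltW.
- by move=> x xa; exact: (is_derive_continuous (D x xa)).
rewrite mul0r primitive0 /kinetic expr0n /= subr0 sqrtr1; lra.
Qed.

(** Origin of the condition [primitive g xi < 1]: an initial energy below the supremum 1 of
    [kinetic] determines a truncation level [a < 1]. *)
Lemma kinetic_surj e : 0 < e < 1 -> exists2 a : R, 0 < a < 1 & kinetic a = e.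
Proof.
move=> /andP[e0 e1]; exists (Num.sqrt (1 - (1 - e) ^+ 2)).
  have h : 0 < 1 - (1 - e) ^+ 2 by nra.
  by rewrite sqrtr_gt0 h /= -[ltRHS]sqrtr1 ltr_sqrt //; nra.
rewrite /kinetic sqr_sqrtr ?subKr; last by nra.
by rewrite sqrtr_sqr ger0_norm ?subKr //; lra.
Qed.

End CurvatureFlux.

(** * Radial profiles *)

Section Profile.
Context {R : realType}.
Implicit Types (g v q : R -> R) (r s t x : R).

(* The solution is [u x = v |x|], and [x *: q |x|] is the vector field
   [grad u / sqrt (1 + |grad u|^2)]; the dimension is [n.+1]. *)
Record profile (n : nat) g xi v q : Prop := Profile {
  profile_cv : continuous v;
  profile_cq : continuous q;
  profile_v_even : forall r, v (- r) = v r;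
  profile_q_even : forall r, q (- r) = q r;
  profile_v0 : v 0 = xi;
  profile_q0 : n.+1%:R * q 0 = - g xi;
  profile_dv : forall r, 0 < r -> is_derive r (1 : R) v (slope (r * q r));
  profile_dw : forall r, 0 < r ->
    is_derive r (1 : R) (fun t => t * q t) (- g (v r) - n%:R * q r);
  profile_v_le : forall r, `|v r| <= `|xi|;
  profile_w_lt : forall r, `|r * q r| < 1 }.

Lemma profile_opp n g xi v q : odd_fun g -> profile n g xi v q ->
  profile n g (- xi) (fun r => - v r) (fun r => - q r).
Proof.
move=> og [cv cq ev eq v0 q0 dv dw vle wlt]; split.
- by move=> r; apply: cvgN; exact: cv.
- by move=> r; apply: cvgN; exact: cq.
- by move=> r; rewrite ev.
- by move=> r; rewrite eq.
- by rewrite v0.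
- by rewrite mulrN q0 og.
- by move=> r r0; rewrite mulrN slope_odd; apply: is_derive_opp; exact: dv.
- move=> r r0; rewrite (_ : (fun t => _) = (fun t => - (t * q t))); last first.
    by apply/funext => t; rewrite mulrN.
  by apply: (is_derive_val (is_derive_opp (dw _ r0))); rewrite og; ring.
- by move=> r; rewrite !normrN.
- by move=> r; rewrite mulrN normrN.
Qed.

Section Flux.
Variables (n : nat) (h v : R -> R) (M : R).
Hypotheses (ch : continuous h) (cv : continuous v).
Local Notation w := (flux n h v).

Lemma is_derive_flux r : 0 < r ->
  is_derive r (1 : R) w (- h (v r) - n%:R * (w r / r)).
Proof.
move=> r0; pose P := primitive (fun t => t ^+ n * h (v t)).
have rn0 : r ^+ n != 0 by rewrite expf_neq0 // gt_eqF.
have wE t : 0 < t -> w t = - P t * (t ^+ n)^-1.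
  by move=> t0; rewrite /flux ger0_norm // ltW.
apply: (@is_derive_near_eq _ _ (fun t => - P t * (t ^+ n)^-1)).
  by near=> t; apply: wE; near: t; exact: lt_nbhsr.
have dP : is_derive r (1 : R) P (r ^+ n * h (v r)).
  by apply: is_derive_primitive; exact: flux_integrand_continuous.
apply: (is_derive_val (is_derive_mul (is_derive_opp dP)
  (is_derive_inv (f := fun t => t ^+ n) rn0 (is_derive_pow r n)))).
rewrite wE //; case: n rn0 => [|k] rn0.
  by rewrite !expr0 invr1; ring.
rewrite succnK exprS; field.
by rewrite expf_neq0 gt_eqF.
Unshelve. all: by end_near. Qed.

(** The value at 0 is the limit: near the origin [h (v t)] is close to [h (v 0)], so the flux is
    close to [- h (v 0) * r / (n + 1)]. *)
Definition flux_quotient r := if r == 0 then - h (v 0) / n.+1%:R else w r / `|r|.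

Lemma flux_quotient_even r : flux_quotient (- r) = flux_quotient r.
Proof. by rewrite /flux_quotient oppr_eq0 /flux normrN. Qed.

Lemma mul_flux_quotient r : 0 <= r -> r * flux_quotient r = w r.
Proof.
rewrite le_eqVlt /flux_quotient => /predU1P[<-|r0]; first by rewrite mul0r flux0.
by rewrite gt_eqF // ger0_norm ?(ltW r0) // mulrC divfK // gt_eqF.
Qed.

(** Subtracting [h (v 0) * t^(n + 1) / (n + 1)] from the primitive leaves a function with derivative
    [t^n (h (v t) - h (v 0))], to which the mean value theorem applies. *)
Lemma flux_quotient_dist r : 0 < r ->
  exists2 c, 0 < c < r & `|flux_quotient r - flux_quotient 0| <= `|h (v c) - h (v 0)|.
Proof.
move=> r0; pose P := primitive (fun t => t ^+ n * h (v t)).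
have rS0 : 0 < r ^+ n.+1 by rewrite exprn_gt0.
pose F t := P t - h (v 0) / n.+1%:R * t ^+ n.+1.
have dF t : is_derive t (1 : R) F (t ^+ n * (h (v t) - h (v 0))).
  have d1 := is_derive_primitive t (flux_integrand_continuous (n := n) ch cv).
  have d2 := is_derive_scale (h (v 0) / n.+1%:R) (is_derive_pow t n.+1).
  apply: (is_derive_val (is_derive_sub d1 d2)).
  by rewrite succnK; field; rewrite ?natr1 ?nat1r pnatr_eq0.
have [|c /andP[c0 cr] ] := mean_value r0 (fun x _ => dF x).
  by move=> x _; exact: (is_derive_continuous (dF x)).
rewrite /F /P primitive0 expr0n mulr0 !subr0 -/P => e.
exists c; first by rewrite c0.
rewrite /flux_quotient eqxx gt_eqF // /flux (ger0_norm (ltW r0)) -/P.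
have -> : - P r / r ^+ n / r - - h (v 0) / n.+1%:R =
    - (P r - h (v 0) / n.+1%:R * r ^+ n.+1) / r ^+ n.+1.
  by rewrite exprSr; field; rewrite nat1r pnatr_eq0 expf_neq0 ?gt_eqF.
rewrite e normrM normrN normfV (gtr0_norm rS0) ler_pdivrMr //.
rewrite !normrM (gtr0_norm r0) normrX (gtr0_norm c0) mulrAC exprSr mulrC.
rewrite ler_wpM2l // ler_wpM2r ?(ltW r0) //.
by rewrite lerXn2r // ?nnegrE ltW.
Qed.

Hypotheses (hM : forall s, `|h s| <= M).

Lemma flux_quotient_continuous : continuous flux_quotient.
Proof.
move=> r; have [->|r0] := eqVneq r 0; last first.
  have c1 : {for r, continuous (fun t => w t / `|t|)}.
    apply: cvgM; first exact: (flux_continuous ch hM hM).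
    by apply: cvgV; [rewrite normr_eq0|exact: norm_continuous].
  have nr : \forall t \near r, t != 0 by exact: neq_nearby.
  rewrite /continuous_at; have -> : flux_quotient r = w r / `|r|.
    by rewrite /flux_quotient (negbTE r0).
  apply: cvg_trans c1; apply: near_eq_cvg; near=> t.
  rewrite /flux_quotient ifN //; near: t; exact: nr.
apply/cvgrPdist_le => e e0.
have cc : {for 0, continuous (h \o v)} by apply: continuous_comp; [exact: cv|exact: ch].
have /cvgrPdist_le /(_ e e0) := cc.
move=> /nbhs_ballP[d /= d0 hd]; near=> t.
have [->|tn0] := eqVneq t 0; first by rewrite subrr normr0 ltW.
have td : `|t| < d by 
  near: t; apply/nbhs_ballP; exists d => // y;
    by rewrite /ball /= sub0r normrN.
have -> : flux_quotient t = flux_quotient `|t|.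
  by case: ger0P => _ //; rewrite flux_quotient_even.
have t0 : 0 < `|t| by rewrite normr_gt0.
have [c /andP[c0 ct] hc] := flux_quotient_dist t0.
rewrite distrC (le_trans hc) // distrC; apply: hd.
by rewrite /ball /= sub0r normrN gtr0_norm // (lt_trans ct).
Unshelve. all: by end_near. Qed.

End Flux.

Theorem profile_exists n g (xi : R) : continuous g -> odd_fun g -> 0 < xi ->
  (forall s, 0 < s <= xi -> 0 < g s) -> primitive g xi < 1 ->
  exists v q, profile n g xi v q.
Proof.
move=> cg og xi0 gpos G1.
have cg' x : `|x| <= xi -> {for x, continuous g} by move=> _; exact: cg.
pose h := g \o clamp xi; pose G := primitive h.
have ch : continuous h := clamped_continuous xi0 cg'.
have GE : G xi = primitive g xi := clamped_primitiveE g xi0.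
have G0 : 0 < primitive g xi.
  have [||c /andP[c0 cx] ] := mean_value (f := primitive g) (df := g) xi0.
  - by move=> x _; exact: is_derive_primitive.
  - by move=> x _; exact: primitive_continuous.
  by rewrite primitive0 !subr0 => ->; rewrite mulr_gt0 // gpos // c0 ltW.
(* The level [a] is chosen so that the kinetic energy at [a] equals the whole initial energy. *)
have [a /andP[a0 a1] Ka] := kinetic_surj (introT andP (conj G0 G1)).
have cs x : `|x| <= a -> {for x, continuous slope}.
  by move=> xa; apply: slope_continuous; rewrite (le_lt_trans xa).
have spos x : 0 < x <= a -> 0 < slope x.
  by move=> /andP[x0 xa]; rewrite slope_gt0 // x0 (le_lt_trans xa).
pose p := slope \o clamp a; pose H := primitive p.
have cp : continuous p := clamped_continuous a0 cs.
have HE : H a = primitive g xi by rewrite /H /p primitive_clamped_slope ?a0.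
have [M1 hM1] := clamped_bounded xi0 cg'.
have [M2 hM2] := clamped_bounded a0 cs.
pose M := Num.max M1 M2.
have hM s : `|h s| <= M by rewrite le_max hM1.
have pM s : `|p s| <= M by rewrite le_max hM2 orbT.
have [v [cv v0 vE] ] := peano n xi ch cp hM pM.
pose w := flux n h v.
have cw : continuous w := flux_continuous ch hM hM cv.
have dv r : 0 < r -> is_derive r (1 : R) v (p (w r)).
  move=> r0; apply: (@is_derive_near_eq _ _ (picard n h p xi v)).
    by near=> t; apply: vE; apply: ltW; near: t; exact: lt_nbhsr.
  exact: is_derive_picard.
have dw r (r0 : 0 < r) := is_derive_flux n ch cv r0.
pose E r := G (v r) + H (w r).
have dE r : 0 < r -> is_derive r (1 : R) E (- (n%:R / r * (w r * p (w r)))).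
  move=> r0; apply: (is_derive_val (is_derive_add
    (is_derive_comp1 (is_derive_primitive _ ch) (dv r r0))
    (is_derive_comp1 (is_derive_primitive _ cp) (dw r r0)))).
  by rewrite -/w; ring.
have p_mul x : 0 <= x * p x.
  have [x0|x0|->] := ltgtP x 0; last by rewrite mul0r.
  - rewrite -mulrNN mulr_ge0 ?oppr_ge0 ?(ltW x0) //.
    rewrite -oppr_ge0 -(clamped_odd a0 slope_odd x : p (- x) = - p x) ltW //.
    by rewrite (clamped_gt0 a0 spos) // oppr_gt0.
  - by rewrite mulr_ge0 ?(ltW x0) // ltW // (clamped_gt0 a0 spos).
have Ele r : 0 <= r -> E r <= primitive g xi.
  move=> r0; have -> : primitive g xi = E 0.
    by rewrite /E v0 /w flux0 /H primitive0 addr0.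
  apply: (ge_of_derive_le0 (df := fun r => - (n%:R / r * (w r * p (w r))))) => // x.
  - by move=> /andP[x0 _]; exact: dE.
  - move=> _; apply: cvgD.
      by apply: continuous_comp; [exact: cv|exact: primitive_continuous].
    by apply: continuous_comp; [exact: cw|exact: primitive_continuous].
  - move=> /andP[x0 _]; rewrite oppr_le0 mulr_ge0 // divr_ge0 //; exact: ltW.
have vle r : 0 <= r -> `|v r| <= xi.
  move=> r0; apply: (clamped_primitive_inv xi0 cg' og gpos); rewrite -/h -/G GE.
  by apply: le_trans (Ele _ r0); rewrite lerDl (clamped_primitive_ge0 a0 cs slope_odd spos).
have wle r : 0 <= r -> `|w r| <= a.
  move=> r0; apply: (clamped_primitive_inv a0 cs slope_odd spos); rewrite -/p -/H HE.
  by apply: le_trans (Ele _ r0); rewrite lerDr (clamped_primitive_ge0 xi0 cg' og gpos).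
have hE r : 0 <= r -> h (v r) = g (v r) by move=> r0; rewrite /h /= clamp_id // vle.
have pE r : 0 <= r -> p (w r) = slope (w r) by move=> r0; rewrite /p /= clamp_id // wle.
(* The Peano solution satisfies the equation only for [r >= 0], hence the even extension. *)
exists (fun r => v `|r|), (flux_quotient n h v); split.
- by move=> r; apply: continuous_comp; [exact: norm_continuous|exact: cv].
- exact: flux_quotient_continuous ch cv hM.
- by move=> r; rewrite normrN.
- by move=> r; rewrite flux_quotient_even.
- by rewrite normr0 v0.
- by rewrite /flux_quotient eqxx v0 /h /= clamp_id ?ger0_norm ?(ltW xi0) // mulrC divfK.
- move=> r r0; rewrite mul_flux_quotient ?(ltW r0) // -pE ?(ltW r0) //.
  apply: (@is_derive_near_eq _ _ v); last exact: dv.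
  by near=> t; rewrite ger0_norm // ltW //; near: t; exact: lt_nbhsr.
- move=> r r0; rewrite ger0_norm ?(ltW r0) //; apply: (@is_derive_near_eq _ _ w).
    by near=> t; rewrite mul_flux_quotient // ltW //; near: t; exact: lt_nbhsr.
  apply: (is_derive_val (dw r r0)); rewrite hE ?(ltW r0) //.
  by rewrite /flux_quotient gt_eqF // ger0_norm // ltW.
- by move=> r; rewrite (ger0_norm (ltW xi0)) vle.
- move=> r; rewrite -(normr_id (r * _)) normrM.
  have -> : `|flux_quotient n h v r| = `|flux_quotient n h v `|r| |.
    by case: (ger0P r) => _ //; rewrite flux_quotient_even.
  by rewrite -{1}(normr_id r) -normrM normr_id mul_flux_quotient // (le_lt_trans (wle _ _)).
Unshelve. all: by end_near. Qed.

End Profile.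

(** * Sign changes *)

Section Asymptotics.
Context {R : realType}.
Implicit Types (g v q : R -> R) (r s t x k e : R).

(** Near 0, differentiability gives [g s >= g'(0) s / 2]. Away from 0, [g] has a positive minimum
    [g c], and [s <= xi] turns it into the slope [g c / xi]. *)
Lemma linear_lower_bound g (xi : R) : continuous g -> odd_fun g -> 0 < xi ->
  (forall s, 0 < s <= xi -> 0 < g s) -> positive_derivative_at_0 g ->
  exists2 k : R, 0 < k & forall s, 0 <= s <= xi -> k * s <= g s.
Proof.
move=> cg og xi0 gpos [dg g'0].
have g0 : g 0 = 0 by have := og 0; rewrite oppr0 => e; lra.
have hD : h^-1 *: (g (h *: 1 + 0) - g 0) @[h --> 0^'] --> g^`()%classic 0.
  by rewrite derive1E; exact: dg.
have /cvgrPdist_le /(_ (g^`()%classic 0 / 2)) := hD.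
rewrite divr_gt0 // => /(_ isT) [d /= d0 hd].
pose b := Num.min (d / 2) xi.
have b0 : 0 < b by rewrite lt_min divr_gt0 // xi0.
have bxi : b <= xi by rewrite ge_min lexx orbT.
have bd : b < d by rewrite gt_min; apply/orP; left; lra.
have [||c cb hc] := @EVT_min R g b xi => //.
  by apply: continuous_subspaceT => x; exact: cg.
have gc0 : 0 < g c.
  by move: cb; rewrite in_itv /= => /andP[h1 h2]; rewrite gpos // h2 (lt_le_trans b0).
exists (Num.min (g^`()%classic 0 / 2) (g c / xi)).
  by rewrite lt_min !divr_gt0.
move=> s /andP[s0 sxi]; have [sb|bs] := ltrP s b; last first.
  apply: (@le_trans _ _ (g c / xi * s)).
    by rewrite ler_wpM2r // ge_min lexx orbT.
  apply: (@le_trans _ _ (g c)); last by apply: hc; rewrite in_itv /= bs.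
  by rewrite mulrAC ler_pdivrMr // ler_pM2l.
have [->|sn0] := eqVneq s 0; first by rewrite mulr0 g0.
have sp : 0 < s by rewrite lt_neqAle eq_sym sn0.
have := hd s; rewrite /= sub0r normrN (ger0_norm s0) => /(_ (lt_trans sb bd) sn0).
rewrite addr0 /GRing.scale /= mulr1 g0 subr0 mulrC ler_norml => /andP[_ h].
apply: (@le_trans _ _ (g^`()%classic 0 / 2 * s)).
  by rewrite ler_wpM2r // ge_min lexx.
by rewrite -ler_pdivlMr //; lra.
Qed.

Variables (n : nat) (g : R -> R).
Hypotheses (cg : continuous g) (og : odd_fun g).

Section Common.
Variables (xi : R) (v q : R -> R).
Hypothesis P : profile n g xi v q.

Lemma profile_w_continuous : continuous (fun r => r * q r).
Proof. by move=> r; apply: cvgM; [exact: cvg_id|exact: (profile_cq P)]. Qed.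

Lemma profile_dq r : 0 < r ->
  is_derive r (1 : R) q ((- g (v r) - n.+1%:R * q r) / r).
Proof.
move=> r0; have rn0 : r != 0 by rewrite gt_eqF.
apply: (@is_derive_near_eq _ _ (fun t => t * q t * t^-1)).
  near=> t; rewrite mulrAC divff ?mul1r //; near: t; exact: neq_nearby.
apply: (is_derive_val (is_derive_mul (profile_dw P r0)
  (is_derive_inv (f := id) rn0 (is_derive_id _ _)))).
by rewrite -natr1; field.
Unshelve. all: by end_near. Qed.

Lemma profile_sign (r0 r1 : R) : (forall r, r0 < r -> v r != 0) -> r0 < r1 -> 0 < v r1 ->
  forall r, r0 < r -> 0 < v r.
Proof.
move=> vn0 r01 v1 r rr; rewrite lt_neqAle eq_sym vn0 //= leNgt; apply/negP => vr.
have cv a b : {within `[a, b], continuous v}.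
  by apply: continuous_subspaceT; exact: (profile_cv P).
have [le|/ltW le] := lerP r r1.
  have [|c] := @IVT R v r r1 0 le (cv _ _).
    by rewrite min_l ?max_r ?(ltW vr) ?(ltW v1) // (le_trans (ltW vr)) // ltW.
  rewrite in_itv /= => /andP[rc _] vc; have := vn0 c (lt_le_trans rr rc).
  by rewrite vc eqxx.
have [|c] := @IVT R v r1 r 0 le (cv _ _).
  by rewrite min_r ?max_l ?(ltW vr) ?(ltW v1) // (le_trans (ltW vr)) // ltW.
rewrite in_itv /= => /andP[rc _] vc; have := vn0 c (lt_le_trans r01 rc).
by rewrite vc eqxx.
Qed.

(* [y = - w / v] satisfies the Riccati inequality [y' >= k + y^2 - n y / r], which forces blow-up
   in finite time. *)
Lemma profile_not_eventually_pos k (r0 : R) : 0 < k ->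
  (forall s, 0 <= s <= `|xi| -> k * s <= g s) -> 0 <= r0 ->
  ~ (forall r, r0 < r -> 0 < v r).
Proof.
move=> k0 gk r00 vpos.
(* Beyond [r1] both [r >= 1] and [r >= n^2 / k], hence [(n / r)^2 <= k]. Young's inequality then
   absorbs [n y / r] and leaves [y' >= (k + y^2) / 2 >= c (1 + y^2)]. *)
pose r1 := r0 + 1 + n%:R ^+ 2 / k.
have r01 : r0 < r1.
  by rewrite /r1 -addrA ltrDl ltr_pwDl // divr_ge0 ?sqr_ge0 // ltW.
have rge1 r : r1 <= r -> 1 <= r.
  apply: le_trans; rewrite /r1 addrAC lerDr addr_ge0 // divr_ge0 ?sqr_ge0 //; exact: ltW.
have nk r : r1 <= r -> n%:R ^+ 2 <= k * r ^+ 2.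
  move=> hr; have h1 := rge1 _ hr.
  have h2 : n%:R ^+ 2 / k <= r.
    by apply: le_trans hr; rewrite /r1 lerDr addr_ge0.
  rewrite mulrC -ler_pdivrMr // (le_trans h2) // expr2 ler_peMr //.
  by rewrite (le_trans ler01).
pose y r := - (r * q r) / v r.
pose c := Num.min k 1 / 2.
have c0 : 0 < c by rewrite divr_gt0 // lt_min k0 /=.
have ck : c <= k / 2 by rewrite ler_wpM2r // ge_min lexx.
have c1 : c <= 1 / 2 by rewrite ler_wpM2r // ge_min lexx orbT.
pose dy r := g (v r) / v r + n%:R * (q r / v r) + (r * q r) * slope (r * q r) / v r ^+ 2.
have hdy r : r1 <= r -> is_derive r (1 : R) y (dy r).
  move=> hr; have rp : 0 < r := lt_le_trans ltr01 (rge1 _ hr).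
  have vp : v r != 0 by rewrite gt_eqF // vpos // (lt_le_trans r01).
  apply: (is_derive_val (is_derive_mul (is_derive_opp (profile_dw P rp))
    (is_derive_inv vp (profile_dv P rp)))).
  by rewrite /dy; field.
have dyge r : r1 <= r -> c * (1 + y r ^+ 2) <= dy r.
  move=> hr; have rp : 0 < r := lt_le_trans ltr01 (rge1 _ hr).
  have vp : 0 < v r by rewrite vpos // (lt_le_trans r01).
  have h1 : k <= g (v r) / v r.
    rewrite ler_pdivlMr // gk // (ltW vp) /=.
    by have := profile_v_le P r; rewrite (gtr0_norm vp).
  have h2 : y r ^+ 2 <= (r * q r) * slope (r * q r) / v r ^+ 2.
    rewrite /y expr_div_n sqrrN ler_wpM2r ?invr_ge0 ?sqr_ge0 //.
    exact: mul_slope_ge (profile_w_lt P r).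
  have h3 : n%:R * (q r / v r) = - (n%:R / r) * y r.
    by rewrite /y; field; rewrite !gt_eqF.
  have h4 : (n%:R / r) ^+ 2 <= k.
    by rewrite expr_div_n ler_pdivrMr ?exprn_gt0 // nk.
  have h5 := sqr_ge0 (n%:R / r - y r).
  rewrite /dy h3; move: h2 h4 h5 h1.
  set Y := y r; set A := n%:R / r; set S := _ * _ / _; set B := g _ / _ => h2 h4 h5 h1.
  have h6 := sqr_ge0 Y; nra.
(* The Riccati inequality is integrated through [(atan y)' = y' / (1 + y^2) >= c]. *)
have mono r : r1 <= r -> atan (y r1) - c * r1 <= atan (y r) - c * r.
  move=> hr; pose D t := (1 + y t ^+ 2)^-1 * dy t - c * 1.
  have hD t : r1 <= t -> is_derive t (1 : R) (fun t => atan (y t) - c * t) (D t).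
    move=> ht; apply: (is_derive_sub _ (is_derive_scale (f := id) c (is_derive_id _ _))).
    by apply: is_derive_comp1 (hdy _ ht); exact: is_derive1_atan.
  apply: (nondecreasing_of_derive hr (fun t ht => hD t (andP ht).1)) => t /andP[ht _].
  have yp : 0 < 1 + y t ^+ 2 by rewrite ltr_pwDl // sqr_ge0.
  by rewrite /D mulr1 subr_ge0 mulrC ler_pdivlMr // dyge.
have p0 : 0 < pi :> R by exact: pi_gt0.
(* Over a length [pi / c], [atan y] would grow by at least [pi], the length of its open range. *)
have := mono (r1 + pi / c); rewrite lerDl divr_ge0 ?(ltW p0) ?(ltW c0) // => /(_ isT).
have -> : c * (r1 + pi / c) = c * r1 + pi by field; rewrite gt_eqF.
have := atan_gtNpi2 (y r1); have := atan_ltpi2 (y (r1 + pi / c)); lra.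
Qed.

End Common.

Lemma profile_zeros_unbounded xi v q k : profile n g xi v q -> 0 < k ->
  (forall s, 0 <= s <= `|xi| -> k * s <= g s) ->
  forall r0, 0 <= r0 -> exists2 r : R, r0 < r & v r = 0.
Proof.
move=> P k0 gk r0 r00; apply: contrapT => hn.
have vn0 r : r0 < r -> v r != 0.
  by move=> hr; apply/eqP => vr; apply: hn; exists r.
have r01 : r0 < r0 + 1 by rewrite ltrDl.
have := vn0 _ r01; rewrite neq_lt => /orP[vneg|vpos].
  apply: (profile_not_eventually_pos (profile_opp og P) k0 _ r00); first by rewrite normrN.
  apply: (profile_sign (profile_opp og P) _ r01); last by rewrite oppr_gt0.
  by move=> r hr; rewrite oppr_eq0 vn0.
by apply: (profile_not_eventually_pos P k0 gk r00); exact: (profile_sign P vn0 r01).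
Qed.

End Asymptotics.

(** * The first zero in dimension one *)

Section OneDimensional.
Context {R : realType}.
Implicit Types (g v q : R -> R) (r s t x k e : R).

(** If [v] stayed positive, [w' = - g v] would be negative, so [w <= w 1 < 0] from time 1 on. Since
    [slope w <= w] for negative [w], [v] would then decrease at least linearly. *)
Lemma profile_zero_dim1 g (xi : R) v q : 0 < xi -> (forall s, 0 < s <= xi -> 0 < g s) ->
  profile 0 g xi v q -> exists2 T : R, 0 < T & v T = 0.
Proof.
move=> xi0 gpos P; apply: contrapT => hn.
have vn0 r : 0 < r -> v r != 0.
  by move=> hr; apply/eqP => vr; apply: hn; exists r.
have vpos r : 0 <= r -> 0 < v r.
  rewrite le_eqVlt => /predU1P[<-|r0]; first by rewrite (profile_v0 P).
  rewrite lt_neqAle eq_sym vn0 //= leNgt; apply/negP => vr.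
  have [||c] := @IVT R v 0 r 0 (ltW r0).
  - by apply: continuous_subspaceT; exact: (profile_cv P).
  - by rewrite (profile_v0 P) min_r ?max_l ?(ltW vr) ?(ltW xi0) // (le_trans (ltW vr)) // ltW.
  rewrite in_itv /= => /andP[c0 _] vc; move: c0; rewrite le_eqVlt => /predU1P[c0|c0].
    by have := profile_v0 P; rewrite c0 vc => /esym; apply/eqP; rewrite gt_eqF.
  by have := vn0 c c0; rewrite vc eqxx.
have gv r : 0 <= r -> 0 < g (v r).
  move=> r0; rewrite gpos // vpos //=.
  by have := profile_v_le P r; rewrite !gtr0_norm ?vpos.
have dw r : 0 < r -> is_derive r (1 : R) (fun t => t * q t) (- g (v r)).
  by move=> r0; apply: (is_derive_val (profile_dw P r0)); rewrite mul0r subr0.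
have cw := profile_w_continuous P.
have w1 : 1 * q 1 < 0.
  have [|c /andP[c0 _]] := mean_value ltr01 (fun x (hx : 0 < x < 1) => dw x (andP hx).1).
    by move=> x _; exact: cw.
  rewrite mul0r !subr0 mulr1 => ->.
  by rewrite oppr_lt0 gv // ltW.
have wle r : 1 <= r -> r * q r <= 1 * q 1.
  move=> r1; apply: (ge_of_derive_le0 (f := fun t => t * q t) (df := fun x => - g (v x)) r1).
  - by move=> x /andP[x1 _]; apply: dw; apply: lt_trans x1.
  - by move=> x _; exact: cw.
  - by move=> x /andP[x1 _]; rewrite oppr_le0 ltW // gv // ltW // (lt_trans _ x1).
have sle r : 1 <= r -> slope (r * q r) <= 1 * q 1.
  move=> r1; apply: le_trans (wle r r1); have w0 := le_lt_trans (wle r r1) w1.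
  by rewrite -(ler_nM2l w0) -expr2 mul_slope_ge // (profile_w_lt P).
have vle r : 1 <= r -> v r - 1 * q 1 * r <= v 1 - 1 * q 1 * 1.
  move=> r1.
  have hD t : 1 <= t -> is_derive t (1 : R) (fun t => v t - 1 * q 1 * t)
      (slope (t * q t) - 1 * q 1 * 1).
    move=> t1; apply: (is_derive_sub _ (is_derive_scale (f := id) _ (is_derive_id _ _))).
    exact: (profile_dv P (lt_le_trans ltr01 t1)).
  apply: (nonincreasing_of_derive r1 (fun t ht => hD t (andP ht).1)) => t /andP[ht _].
  by rewrite mulr1 subr_le0 sle.
have v1 := vpos 1 ler01; move: w1 vle; set a := 1 * q 1 => w1 vle.
(* Time at which the linear upper bound for [v] reaches 0. *)
have := vle (1 - v 1 / a); rewrite lerDl oppr_ge0 pmulr_rle0 // invr_le0 ltW // => /(_ isT).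
have := vpos (1 - v 1 / a); rewrite addr_ge0 ?oppr_ge0 ?pmulr_rle0 ?invr_le0 ?(ltW w1) //.
move=> /(_ isT); rewrite mulrBr [a * (_ / a)]mulrC divfK ?lt_eqF //; lra.
Qed.

End OneDimensional.

(** * Decay *)

Section Decay.
Context {R : realType}.
Implicit Types (r s t x e : R).

Variables (n : nat) (g : R -> R) (xi k M : R) (v q : R -> R).
Hypotheses (cg : continuous g) (og : odd_fun g) (n0 : (0 < n)%N) (k0 : 0 < k).
Hypotheses (gk : forall s, 0 <= s <= `|xi| -> k * s <= g s).
Hypotheses (gM : forall s, 0 <= s <= `|xi| -> g s <= M).
Hypothesis P : profile n g xi v q.

Local Notation G := (primitive g).

Lemma potential_bounds s : `|s| <= `|xi| -> k * s ^+ 2 / 2 <= G s <= M * `|s|.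
Proof.
wlog s0 : s / 0 <= s.
  move=> H; have [/H //|/ltW s0] := lerP 0 s.
  by rewrite -(normrN s) -(primitive_even s cg og) -sqrrN; apply: H; rewrite oppr_ge0.
rewrite (ger0_norm s0) => sxi; apply/andP; split.
  have hD t : is_derive t (1 : R) (fun t => G t - k / 2 * t ^+ 2) (g t - k / 2 * (2 * t ^+ 1)).
    exact: (is_derive_sub (is_derive_primitive t cg) (is_derive_scale _ (is_derive_pow t 2))).
  have := nondecreasing_of_derive s0 (fun x _ => hD x).
  rewrite primitive0 expr0n mulr0 subr0 => H.
  rewrite mulrAC -subr_ge0; apply: H => x /andP[x0 xs].
  have := gk (s := x); rewrite x0 (le_trans xs sxi) => /(_ isT); rewrite expr1; lra.
have hD t : is_derive t (1 : R) (fun t => G t - M * t) (g t - M * 1).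
  exact: (is_derive_sub (is_derive_primitive t cg) (is_derive_scale (f := id) _ (is_derive_id _ _))).
have := nonincreasing_of_derive s0 (fun x _ => hD x).
rewrite primitive0 mulr0 subr0 subr_le0; apply => x /andP[x0 xs].
by rewrite mulr1 subr_le0 gM // x0 (le_trans xs).
Qed.

Lemma restoring_ge s : `|s| <= `|xi| -> k * s ^+ 2 <= s * g s.
Proof.
wlog s0 : s / 0 <= s.
  move=> H; have [/H //|/ltW s0] := lerP 0 s.
  by rewrite -(normrN s) -sqrrN -(mulrNN s) -og; apply: H; rewrite oppr_ge0.
rewrite (ger0_norm s0) => sxi; rewrite expr2 mulrCA ler_wpM2l // gk //.
by rewrite s0.
Qed.

Let E r := G (v r) + kinetic (r * q r).

Lemma is_derive_energy r : 0 < r ->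
  is_derive r (1 : R) E (- (n%:R * (q r * slope (r * q r)))).
Proof.
move=> r0; apply: (is_derive_val (is_derive_add
  (is_derive_comp1 (is_derive_primitive _ cg) (profile_dv P r0))
  (is_derive_comp1 (g := fun t => t * q t) (is_derive_kinetic (profile_w_lt P r))
    (profile_dw P r0)))).
by ring.
Qed.

Lemma slope_mul_ge0 r : 0 < r -> 0 <= q r * slope (r * q r).
Proof.
move=> r0; rewrite -(pmulr_rge0 _ r0) mulrA (le_trans (sqr_ge0 (r * q r))) //.
exact: mul_slope_ge (profile_w_lt P r).
Qed.

Lemma energy_nonincreasing r s : 0 < r -> r <= s -> E s <= E r.
Proof.
move=> r0 rs; have hD t (ht : r <= t) := is_derive_energy (lt_le_trans r0 ht).
apply: (nonincreasing_of_derive rs (fun t ht => hD t (andP ht).1)) => t /andP[ht _].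
by rewrite oppr_le0 mulr_ge0 // slope_mul_ge0 // (lt_le_trans r0).
Qed.

Lemma energy_ge r : k * v r ^+ 2 / 2 <= E r /\ (r * q r) ^+ 2 / 2 <= E r.
Proof.
have /andP[h1 _] := potential_bounds (profile_v_le P r).
have h2 := kinetic_ge (profile_w_lt P r).
have h3 : 0 <= k * v r ^+ 2 / 2 by rewrite divr_ge0 // mulr_ge0 ?sqr_ge0 // ltW.
have h4 : 0 <= (r * q r) ^+ 2 / 2 by rewrite divr_ge0 // sqr_ge0.
by split; rewrite /E; lra.
Qed.

(** Either the kinetic part is at least [e / 2], and [w * slope w] dominates it, or the potential
    part exceeds [e / 2]. In the latter case [G v <= M |v|] forces [|v| >= e / (2 M)], and
    [v * g v >= k v^2] is bounded below. *)
Lemma energy_coercive e : 0 < e -> exists2 c : R, 0 < c &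
  forall r, e <= E r -> c <= (r * q r) * slope (r * q r) + v r * g (v r).
Proof.
(* For [M <= 0] the potential part is at most 0 and the kinetic part carries the whole energy; the
   division by [M] belongs to the other case. *)
move=> e0; have [M0|M0] := lerP M 0.
  exists e => // r; move=> he; apply: (le_trans he); rewrite /E addrC; apply: lerD.
    exact: kinetic_le_mul_slope (profile_w_lt P r).
  have /andP[_ h] := potential_bounds (profile_v_le P r).
  have := restoring_ge (profile_v_le P r); apply: le_trans; apply: (le_trans h).
  apply: (@le_trans _ _ 0); first by rewrite mulr_le0_ge0.
  by rewrite mulr_ge0 ?sqr_ge0 // ltW.
pose d := e / (2 * M).
have d0 : 0 < d by rewrite divr_gt0 // mulr_gt0.
exists (Num.min (e / 2) (k * d ^+ 2)).
  by rewrite lt_min divr_gt0 //= mulr_gt0 // exprn_gt0.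
move=> r he.
have h1 := kinetic_le_mul_slope (profile_w_lt P r).
have h2 := mul_slope_ge (profile_w_lt P r).
have h3 := sqr_ge0 (r * q r).
have h4 := restoring_ge (profile_v_le P r).
have h5 : 0 <= k * v r ^+ 2 by rewrite mulr_ge0 ?sqr_ge0 // ltW.
have /andP[_ h6] := potential_bounds (profile_v_le P r).
have [hk|hk] := lerP (e / 2) (kinetic (r * q r)).
  by apply: (@le_trans _ _ (e / 2)); [rewrite ge_min lexx|lra].
apply: (@le_trans _ _ (k * d ^+ 2)); first by rewrite ge_min lexx orbT.
have hd : d <= `|v r|.
  rewrite /d invfM mulrA ler_pdivrMr // mulrC; move: he; rewrite /E; lra.
have h7 : d ^+ 2 <= v r ^+ 2.
  by rewrite -[v r ^+ 2]real_normK ?num_real // lerXn2r // ?nnegrE // ltW.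
have h8 : k * d ^+ 2 <= k * v r ^+ 2 by rewrite ler_pM2l.
lra.
Qed.

(* Lyapunov functional [E + (n / 2 r) v w]: the cross term makes the dissipation see [v g v]. *)
Let F r := E r + n%:R / 2 * (v r * q r).

(** Half of the dissipation [- (n / r) w * slope w] of [E] pays for the product [slope w * q] coming
    from the cross term. The remainder in [v q / r] is of order [1 / r^2], because [|r q| < 1]. *)
Lemma is_derive_lyapunov r : 0 < r ->
  is_derive r (1 : R) F
   (- (n%:R / 2 / r * ((r * q r) * slope (r * q r) + v r * g (v r)))
    - n%:R * n.+1%:R / 2 * (v r * q r) / r).
Proof.
move=> r0; apply: (is_derive_val (is_derive_add (is_derive_energy r0)
  (is_derive_scale _ (is_derive_mul (profile_dv P r0) (profile_dq P r0))))).
by field; rewrite gt_eqF.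
Qed.

(** While [E >= e], the leading part of [F'] is at most [- n c / (2 r)], whose integral diverges,
    whereas the remainder is integrable. So [F] would tend to minus infinity, although [E >= 0] and
    [v q] is bounded. *)
Lemma energy_small e : 0 < e -> exists2 r : R, 1 <= r & E r < e.
Proof.
move=> e0; apply: contrapT => hn.
have Ee r : 1 <= r -> e <= E r.
  by move=> r1; rewrite leNgt; apply/negP => h; apply: hn; exists r.
have [c c0 hc] := energy_coercive e0.
have nR : 0 < n%:R :> R by rewrite ltr0n.
pose X := `|xi|; have X0 : 0 <= X by exact: normr_ge0.
have vq r : 1 <= r -> `|v r * q r| <= X / r.
  move=> r1; have r0 : 0 < r := lt_le_trans ltr01 r1.
  rewrite ler_pdivlMr // -[Y in _ * Y](gtr0_norm r0) -normrM -mulrA [q r * r]mulrC normrM.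
  by rewrite -[leRHS]mulr1 ler_pM // ?(profile_v_le P) // ltW // (profile_w_lt P).
pose D := n%:R * n.+1%:R / 2 : R.
have D0 : 0 <= D by rewrite divr_ge0 // mulr_ge0.
(* The two added terms integrate the two bounds on [F']: [H] is nonincreasing, yet at least
   [n c ln r / 2 - n X / 2]. *)
pose H r := F r + n%:R / 2 * c * ln r + D * X * r^-1.
pose dH r := (- (n%:R / 2 / r * ((r * q r) * slope (r * q r) + v r * g (v r)))
    - D * (v r * q r) / r) + n%:R / 2 * c * r^-1 + D * X * (- 1 / r ^+ 2).
have hH r : 1 <= r -> is_derive r (1 : R) H (dH r).
  move=> r1; have r0 : 0 < r := lt_le_trans ltr01 r1.
  have rn0 : r != 0 by rewrite gt_eqF.
  exact: (is_derive_add (is_derive_add (is_derive_lyapunov r0)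
    (is_derive_scale _ (is_derive1_ln r0)))
    (is_derive_scale _ (is_derive_inv (f := id) rn0 (is_derive_id _ _)))).
have dH0 r : 1 <= r -> dH r <= 0.
  move=> r1; have r0 : 0 < r := lt_le_trans ltr01 r1.
  have rn0 : r != 0 by rewrite gt_eqF.
  have A0 : 0 <= n%:R / 2 / r by rewrite !divr_ge0 // ltW.
  have h1 := ler_wpM2l A0 (hc r (Ee r r1)).
  have : - (X / r) <= v r * q r by have := vq r r1; rewrite ler_norml => /andP[].
  rewrite -(ler_pM2r (x := r^-1)) ?invr_gt0 // => /(ler_wpM2l D0) h2.
  have e1 : n%:R / 2 * c * r^-1 = n%:R / 2 / r * c by ring.
  have e2 : D * X * (- 1 / r ^+ 2) = D * (- (X / r) / r) by field.
  have e3 : D * (v r * q r) / r = D * (v r * q r / r) by ring.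
  rewrite /dH e1 e2 e3; lra.
have mono r : 1 <= r -> H r <= H 1.
  move=> r1; apply: (nonincreasing_of_derive r1 (fun t ht => hH t (andP ht).1)).
  by move=> t /andP[ht _]; exact: dH0.
have Hge r : 1 <= r -> n%:R / 2 * c * ln r - n%:R / 2 * X <= H r.
  move=> r1; have r0 : 0 < r := lt_le_trans ltr01 r1.
  have h0 : 0 <= E r by apply: le_trans (Ee r r1); exact: ltW.
  have h1 : 0 <= D * X * r^-1 by rewrite !mulr_ge0 // invr_ge0 ltW.
  have h2 : - X <= v r * q r.
    have := vq r r1; rewrite ler_norml => /andP[h _]; apply: le_trans h.
    by rewrite lerN2 ler_pdivrMr // ler_peMr.
  have A0 : 0 <= n%:R / 2 :> R by rewrite divr_ge0 // ltW.
  have := ler_wpM2l A0 h2; rewrite /H /F; lra.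
have nc : 0 < n%:R / 2 * c by rewrite mulr_gt0 // divr_gt0.
(* Value of [ln r] at which the lower bound for [H] equals [|H 1| + 1]. *)
pose T := (`|H 1| + n%:R / 2 * X + 1) / (n%:R / 2 * c).
have T0 : 0 <= T.
  by rewrite divr_ge0 ?(ltW nc) // !addr_ge0 // mulr_ge0 // divr_ge0 // ltW.
have r1 : 1 <= expR T by rewrite -expR0 ler_expR.
have := le_trans (Hge _ r1) (mono _ r1); rewrite expRK /T mulrC divfK ?gt_eqF //.
have := ler_norm (H 1); lra.
Qed.

Theorem profile_decay e : 0 < e ->
  exists2 r0 : R, 1 <= r0 & forall r, r0 <= r -> `|v r| < e /\ `|r * q r| < e.
Proof.
(* Since [k v^2 / 2] and [w^2 / 2] are both at most [E], an energy below [d] makes [|v|] and [|w|]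
   smaller than [e]. *)
move=> e0; pose d := Num.min k 1 * e ^+ 2 / 2.
have m0 : 0 < Num.min k 1 by rewrite lt_min k0 /=.
have d0 : 0 < d by rewrite divr_gt0 // mulr_gt0 // exprn_gt0.
have [r0 r01 Er0] := energy_small d0; exists r0 => // r hr.
have Er : E r < d by apply: le_lt_trans Er0; apply: energy_nonincreasing hr; apply: lt_le_trans r01.
have dk : d <= k * e ^+ 2 / 2.
  by rewrite /d ler_pM2r // ler_pM2r ?exprn_gt0 // ge_min lexx.
have d1 : d <= e ^+ 2 / 2.
  by rewrite /d ler_pM2r // ger_pMl ?exprn_gt0 // ge_min lexx orbT.
have sq x : x ^+ 2 < e ^+ 2 -> `|x| < e.
  by rewrite -[x ^+ 2]real_normK ?num_real // ltr_pXn2r // nnegrE // ltW.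
have [h1 h2] := energy_ge r; split; apply: sq; last by lra.
by rewrite -(ltr_pM2l k0); lra.
Qed.

End Decay.

(** * Periodic unrolling in dimension one *)

Section DirectionalDerivative.
Context {R : realType} {V : normedModType R}.
Implicit Types (f : V -> R) (x w : V) (d : R).

Lemma is_derive_of_cvg f x w d :
  h^-1 *: (f (h *: w + x) - f x) @[h --> 0^'] --> d -> is_derive x w f d.
Proof.
move=> h; apply: DeriveDef; first by apply/cvg_ex; exists d; exact: h.
exact: cvg_lim h.
Qed.

Lemma cvg_of_is_derive f x w d :
  is_derive x w f d -> h^-1 *: (f (h *: w + x) - f x) @[h --> 0^'] --> d.
Proof. by move=> [h <-]; exact: h. Qed.

End DirectionalDerivative.

Lemma is_derive_line {R : realType} {V : normedModType R} (f : V -> R) (x w : V) (d : R) :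
  is_derive (0 : R) (1 : R) (fun h => f (h *: w + x)) d -> is_derive x w f d.
Proof.
move=> hd; have h := cvg_of_is_derive hd; apply: is_derive_of_cvg; apply: cvg_trans h.
apply: near_eq_cvg; near=> h.
by rewrite scale0r add0r addr0 /GRing.scale /= mulr1.
Unshelve. all: by end_near. Qed.

(** * Derivatives at a junction and at an exceptional point *)

Section Gluing.
Context {R : realType}.
Implicit Types (f df : R -> R) (a d t : R).

Lemma is_derive_glue f1 f2 a d : f1 a = f2 a ->
  is_derive a (1 : R) f1 d -> is_derive a (1 : R) f2 d ->
  is_derive a (1 : R) (fun t => if t < a then f1 t else f2 t) d.
Proof.
move=> e d1 d2; have /cvgrPdist_le h1 := cvg_of_is_derive d1.
have /cvgrPdist_le h2 := cvg_of_is_derive d2.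
apply: is_derive_of_cvg; apply/cvgrPdist_le => eps e0.
near=> h; rewrite ltxx; case: ifPn => _; last by near: h; exact: h2.
by rewrite -e; near: h; exact: h1.
Unshelve. all: by end_near. Qed.

(** The mean value theorem on either side of [a] writes the difference quotient as [df c] with [c]
    near [a]. This supplies the derivatives at 0, where the equations of a profile say nothing. *)
Lemma is_derive_removable f df a : (forall t, t != a -> is_derive t (1 : R) f (df t)) ->
  {for a, continuous f} -> {for a, continuous df} -> is_derive a (1 : R) f (df a).
Proof.
move=> hf cf /cvgrPdist_le cdf; apply: is_derive_of_cvg; apply/cvgrPdist_le => e e0.
have /nbhs_ballP[d /= d0 hd] := cdf e e0.
have cf' x : {for x, continuous f}.
  by have [->//|xa] := eqVneq x a; exact: is_derive_continuous (hf x xa).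
near=> h.
have h0 : h != 0 by near: h; exact: nbhs_dnbhs_neq.
have hd' : `|h| < d by near: h; exact: dnbhs0_lt.
suff [c cd ->] : exists2 c, `|a - c| < d & f (h *: 1 + a) - f a = df c * h.
  by rewrite /GRing.scale /= mulrCA mulVf // mulr1; exact: hd.
rewrite /GRing.scale /= mulr1; have [hn|hp|h00] := ltgtP h 0; last by rewrite h00 eqxx in h0.
  have ha : h + a < a by rewrite gtrDr.
  have hf' x (hx : h + a < x < a) := hf x (negbT (lt_eqF (andP hx).2)).
  have [x _|c /andP[c1 c2] e1] := mean_value ha hf'; first exact: cf'.
  exists c; last by rewrite -opprB e1; ring.
  by rewrite gtr0_norm ?subr_gt0 //; move: hd'; rewrite ltr0_norm //; lra.
have ha : a < h + a by rewrite ltrDr.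
have hf' x (hx : a < x < h + a) := hf x (negbT (gt_eqF (andP hx).1)).
have [x _|c /andP[c1 c2] e1] := mean_value ha hf'; first exact: cf'.
exists c; last by rewrite e1 addrK.
by rewrite ltr0_norm ?subr_lt0 //; move: hd'; rewrite gtr0_norm //; lra.
Unshelve. all: by end_near. Qed.

End Gluing.

Section Unroll.
Context {R : realType}.
Implicit Types (f df : R -> R) (s t : R) (k : int).
Variable T : R.
Hypothesis T0 : 0 < T.

Definition shifted f k t : R := (-1) ^ k * f (t - k%:~R * (2 * T)).

(* The extension of [f] from [-T, T] to the line such that [f (t + 2 T) = - f t]. *)
Definition unroll f t : R := shifted f (Num.floor ((t + T) / (2 * T))) t.

Lemma sign_cases k : (-1) ^ k = 1 :> R \/ (-1) ^ k = -1 :> R.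
Proof.
suff H m : (-1) ^+ m = 1 :> R \/ (-1) ^+ m = -1 :> R.
  case: k => m; first exact: H.
  rewrite NegzE -invr_expz; have := H m.+1; rewrite exprnP.
  by case=> ->; [left|right]; rewrite ?invrN invr1.
by rewrite -signr_odd; case: odd; [right|left].
Qed.

Lemma sign_succ k : (-1) ^ (k + 1) = - (-1) ^ k :> R.
Proof. by rewrite expfzDr ?oppr_eq0 ?oner_eq0 // expr1z mulrN1. Qed.

Lemma sign_opp k : (-1) ^ (- k) = (-1) ^ k :> R.
Proof. by rewrite -invr_expz; have [->|->] := sign_cases k; rewrite ?invrN invr1. Qed.

Lemma unroll_index t : exists k, - T <= t - k%:~R * (2 * T) < T.
Proof.
exists (Num.floor ((t + T) / (2 * T))).
have T2 : 0 < 2 * T by rewrite mulr_gt0.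
have /andP[] := floor_itv ((t + T) / (2 * T)).
rewrite ler_pdivlMr // ltr_pdivrMr // intrD => h1 h2.
by apply/andP; split; lra.
Qed.

(** Any index works on the closed interval: at the right end the floor selects [k + 1], but
    antisymmetry makes the two branches agree there. *)
Lemma unrollE f k t : f (- T) = - f T -> - T <= t - k%:~R * (2 * T) <= T ->
  unroll f t = shifted f k t.
Proof.
move=> hf /andP[h1 h2]; have T2 : 0 < 2 * T by rewrite mulr_gt0.
move: h2; rewrite le_eqVlt => /predU1P[h2|h2]; rewrite /unroll.
  rewrite (@floor_def _ _ (k + 1)).
    rewrite /shifted sign_succ h2 intrD.
    have -> : t - (k%:~R + 1) * (2 * T) = - T by lra.
    by rewrite hf mulrNN.
  by rewrite ler_pdivlMr // ltr_pdivrMr // !intrD; apply/andP; split; lra.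
rewrite (@floor_def _ _ k) //.
by rewrite ler_pdivlMr // ltr_pdivrMr // !intrD; apply/andP; split; lra.
Qed.

Lemma unroll_antiperiodic f t : f (- T) = - f T -> unroll f (t + 2 * T) = - unroll f t.
Proof.
move=> hf; have [k /andP[h1 /ltW h2]] := unroll_index t.
rewrite (unrollE (t := t) hf (k := k)) ?h1 // (unrollE hf (k := k + 1)).
  rewrite /shifted sign_succ mulNr intrD; congr (- (_ * f _)); lra.
by rewrite intrD; apply/andP; split; lra.
Qed.

(** The closed interval is symmetric, so if [k] is an index for [t] then [- k] is one for [- t],
    with the same sign; the parity of [f] thus passes to its unrolling. *)
Lemma unroll_opp f t : f (- T) = - f T -> exists k s,
  unroll f t = (-1) ^ k * f s /\ unroll f (- t) = (-1) ^ k * f (- s).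
Proof.
move=> hf; have [k /andP[h1 /ltW h2]] := unroll_index t.
exists k, (t - k%:~R * (2 * T)); rewrite (unrollE (t := t) hf (k := k)) ?h1 //; split=> //.
rewrite (unrollE hf (k := - k)).
  by rewrite /shifted sign_opp intrN; congr (_ * f _); lra.
by rewrite intrN; apply/andP; split; lra.
Qed.

Lemma is_derive_shifted f df k t : (forall s, is_derive s (1 : R) f (df s)) ->
  is_derive t (1 : R) (shifted f k) (shifted df k t).
Proof.
move=> hf; apply: (is_derive_val (is_derive_scale _ (is_derive_comp1 (hf _)
  (is_derive_sub (is_derive_id _ _) (is_derive_const _ _))))).
by rewrite /shifted subr0 mulr1.
Qed.

Lemma is_derive_unroll f df t : (forall s, is_derive s (1 : R) f (df s)) ->
  f (- T) = - f T -> df (- T) = - df T ->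
  is_derive t (1 : R) (unroll f) (unroll df t).
Proof.
move=> hf ef edf; have [k /andP[h1 h2]] := unroll_index t.
rewrite (unrollE edf (k := k)) ?h1 ?(ltW h2) //.
move: h1; rewrite le_eqVlt => /predU1P[h1|h1]; last first.
  apply: (@is_derive_near_eq _ _ (shifted f k)); last exact: is_derive_shifted.
  near=> s; apply: unrollE => //; apply/andP; split.
    rewrite lerBrDr ltW //; near: s; apply: lt_nbhsr; lra.
  rewrite lerBlDr ltW //; near: s; apply: lt_nbhsl; lra.
(* At a junction the branch [k - 1] is at its right end and the branch [k] at its left end; the two
   boundary conditions match their values and their slopes. *)
apply: (@is_derive_near_eq _ _ (fun s => if s < t then shifted f (k - 1) s else shifted f k s)).
  near=> s; case: ltrP => hs; apply: unrollE => //; apply/andP; split.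
  - rewrite intrB lerBrDr ltW //; near: s; apply: lt_nbhsr; lra.
  - by rewrite intrB; lra.
  - by lra.
  - rewrite lerBlDr ltW //; near: s; apply: lt_nbhsl; lra.
have ek : forall h : R -> R, h (- T) = - h T -> shifted h (k - 1) t = shifted h k t.
  move=> h eh; rewrite -[in RHS](subrK 1 k) /shifted sign_succ subrK -h1 eh mulrNN intrB.
  by congr (_ * h _); lra.
apply: is_derive_glue; first exact: ek.
  by rewrite -(ek df edf); exact: is_derive_shifted.
exact: is_derive_shifted.
Unshelve. all: by end_near. Qed.

End Unroll.

(** For [t < 0] the parities reflect the equation; at 0 the derivative is recovered from the
    continuity of [slope w]. *)
Lemma is_derive_profile {R : realType} n g xi (v q : R -> R) t : profile n g xi v q ->
  is_derive t (1 : R) v (slope (t * q t)).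
Proof.
move=> P; pose w s := s * q s; have hv s : s != 0 -> is_derive s (1 : R) v (slope (w s)).
  rewrite neq_lt => /orP[s0|s0]; last exact: (profile_dv P).
  apply: (@is_derive_near_eq _ _ (fun t => v (- t))).
    by near=> x; rewrite (profile_v_even P).
  have ns0 : 0 < - s by rewrite oppr_gt0.
  apply: (is_derive_val (is_derive_comp1 (profile_dv P ns0) (is_derive_opp (is_derive_id _ _)))).
  by rewrite (profile_q_even P) mulNr slope_odd mulrN1 opprK.
rewrite -/(w t); have [->|/hv //] := eqVneq t 0.
apply: (@is_derive_removable _ _ (slope \o w)) => //; first exact: (profile_cv P).
apply: continuous_comp; first exact: (profile_w_continuous P).
by apply: slope_continuous; exact: (profile_w_lt P).
Unshelve. all: by end_near. Qed.

Section Periodic.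
Context {R : realType}.
Implicit Types (r s t : R).
Variables (g : R -> R) (xi : R) (v q : R -> R) (T : R).
Hypotheses (cg : continuous g) (og : odd_fun g).
Hypotheses (P : profile 0 g xi v q) (T0 : 0 < T) (vT : v T = 0).

Let w t := t * q t.

Let w_odd t : w (- t) = - w t.
Proof. by rewrite /w (profile_q_even P) mulNr. Qed.

Let w_continuous : continuous w.
Proof. exact: profile_w_continuous P. Qed.

Let is_derive_v t : is_derive t (1 : R) v (slope (w t)).
Proof. exact: is_derive_profile P. Qed.

Let is_derive_w t : is_derive t (1 : R) w (- g (v t)).
Proof.
have hw s : s != 0 -> is_derive s (1 : R) w (- g (v s)).
  rewrite neq_lt => /orP[s0|s0]; last first.
    by apply: (is_derive_val (profile_dw P s0)); rewrite mul0r subr0.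
  apply: (@is_derive_near_eq _ _ (fun t => - w (- t))).
    by near=> x; rewrite w_odd opprK.
  have ns0 : 0 < - s by rewrite oppr_gt0.
  apply: (is_derive_val (is_derive_opp (is_derive_comp1 (f := w) (profile_dw P ns0)
    (is_derive_opp (is_derive_id _ _))))).
  by rewrite (profile_v_even P); ring.
have [->|/hw //] := eqVneq t 0.
apply: (@is_derive_removable _ _ (fun t => - g (v t))) => //; first exact: w_continuous.
by apply: cvgN; apply: continuous_comp; [exact: (profile_cv P)|exact: cg].
Unshelve. all: by end_near. Qed.

Let V := unroll T v.
Let W := unroll T w.

Let g0 : g 0 = 0.
Proof. by have := og 0; rewrite oppr0 => e; lra. Qed.

Let ev : v (- T) = - v T. Proof. by rewrite (profile_v_even P) vT oppr0. Qed.

Let ew : w (- T) = - w T. Proof. exact: w_odd. Qed.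

Let is_derive_V t : is_derive t (1 : R) V (slope (W t)).
Proof.
apply: (is_derive_val (is_derive_unroll T0 t is_derive_v ev _)).
  by rewrite ew slope_odd.
rewrite /W /unroll /shifted; have [->|->] := @sign_cases R (Num.floor ((t + T) / (2 * T))).
  by rewrite !mul1r.
by rewrite !mulN1r slope_odd.
Qed.

Let is_derive_W t : is_derive t (1 : R) W (- g (V t)).
Proof.
apply: (is_derive_val (is_derive_unroll T0 t is_derive_w ew _)).
  by rewrite ev vT !oppr0 g0 !oppr0.
rewrite /V /unroll /shifted; have [->|->] := @sign_cases R (Num.floor ((t + T) / (2 * T))).
  by rewrite !mul1r.
by rewrite !mulN1r og.
Qed.

Lemma unroll_near0 f t : f (- T) = - f T -> `|t| < T -> unroll T f t = f t.
Proof.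
move=> ef; rewrite ltr_norml => /andP[h1 h2].
rewrite (unrollE T0 ef (k := 0)) /shifted mul0r subr0 ?expr0z ?mul1r //.
by rewrite !ltW.
Qed.

(** As [g] and [slope] are odd, the system is invariant under a change of sign of [v] and [w]. Since
    [v] is even with [v T = 0] and [w] is odd, the state at [- T] is the opposite of the state at
    [T], so the antiperiodic continuation of the arc on [[- T, T]] is a solution of period [4 T].
    The given profile beyond [T] is discarded. *)
Theorem profile_periodic : exists v' q',
  profile 0 g xi v' q' /\ forall r, v' (r + 4 * T) = v' r.
Proof.
(* [W t / t] takes the default value 0 at the origin, so [q] is kept where [W t] is still
   [t * q t]. *)
pose q' t := if `|t| < T then q t else W t / t.
have wE t : t * q' t = W t.
  rewrite /q'; case: ifPn => tT; first by rewrite /W unroll_near0.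
  rewrite mulrC divfK //; apply: contraNneq tT => ->.
  by rewrite normr0.
have Todd : `|0 : R| < T by rewrite normr0.
exists V, q'; split; last first.
  move=> r; have -> : r + 4 * T = r + 2 * T + 2 * T by ring.
  by rewrite /V !(unroll_antiperiodic T0 _ ev) opprK.
split.
- by move=> t; exact: is_derive_continuous (is_derive_V t).
- move=> t; have [->|t0] := eqVneq t 0.
    have h : {for 0, continuous q} by exact: (profile_cq P).
    rewrite /continuous_at /q' Todd; apply: cvg_trans h; apply: near_eq_cvg.
    by near=> s; rewrite ifT //; near: s; exact: nbhs0_lt.
  have h : {for t, continuous (fun s => W s / s)}.
    apply: cvgM; first exact: is_derive_continuous (is_derive_W t).
    by apply: cvgV => //; exact: cvg_id.
  have qE s : s != 0 -> q' s = W s / s by move=> s0; rewrite -wE mulrAC divff // mul1r.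
  have nt := neq_nearby t0.
  rewrite /continuous_at qE //; apply: cvg_trans h; apply: near_eq_cvg.
  by near=> s; rewrite qE //; near: s; exact: nt.
- move=> t; rewrite /V; have [k [s [-> ->]]] := unroll_opp T0 t ev.
  by rewrite (profile_v_even P).
- move=> t; rewrite /q' normrN; case: ifPn => _; first by rewrite (profile_q_even P).
  have [k [s]] := unroll_opp T0 t ew; rewrite -/W => -[-> ->].
  by rewrite w_odd mulrN invrN mulrNN.
- by rewrite /V unroll_near0 // (profile_v0 P).
- by rewrite /q' Todd (profile_q0 P).
- by move=> r r0; rewrite wE; exact: is_derive_V.
- move=> r r0; rewrite mul0r subr0 (_ : (fun t => _) = W); first exact: is_derive_W.
  exact/funext.
- move=> r; rewrite /V /unroll /shifted; have [->|->] := @sign_cases R (Num.floor ((r + T) / (2 * T)));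
    by rewrite ?mul1r ?mulN1r ?normrN (profile_v_le P).
- move=> r; rewrite wE /W /unroll /shifted; have [->|->] := @sign_cases R (Num.floor ((r + T) / (2 * T)));
    by rewrite ?mul1r ?mulN1r ?normrN (profile_w_lt P).
Unshelve. all: by end_near. Qed.

End Periodic.

(** * Radial functions *)

Section ContinuousFor.
Context {R : realType} {T : topologicalType}.
Implicit Types (f g : T -> R) (x : T).

(* Intended for [apply:], so that the goal keeps the form [{for x, continuous f}]. *)
Lemma continuous_of_for f : (forall x, {for x, continuous f}) -> continuous f.
Proof. by []. Qed.

Lemma continuous_for_add f g x : {for x, continuous f} -> {for x, continuous g} ->
  {for x, continuous (fun y => f y + g y)}.
Proof. by move=> cf cg; exact: cvgD cf cg. Qed.

Lemma continuous_for_mul f g x : {for x, continuous f} -> {for x, continuous g} ->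
  {for x, continuous (fun y => f y * g y)}.
Proof. by move=> cf cg; exact: cvgM cf cg. Qed.

Lemma continuous_for_opp f x : {for x, continuous f} -> {for x, continuous (fun y => - f y)}.
Proof. by move=> cf; exact: cvgN cf. Qed.

Lemma continuous_for_inv f x : f x != 0 -> {for x, continuous f} ->
  {for x, continuous (fun y => (f y)^-1)}.
Proof. by move=> f0 cf; exact: cvgV f0 cf. Qed.

Lemma continuous_for_cst (c : R) x : {for x, continuous (fun=> c)}.
Proof. exact: cvg_cst. Qed.

Lemma continuous_for_comp f (h : R -> R) x : {for x, continuous f} ->
  {for f x, continuous h} -> {for x, continuous (fun y => h (f y))}.
Proof. exact: continuous_comp. Qed.

Lemma continuous_for_dominated f g x : f x = 0 -> g x = 0 -> (forall y, `|f y| <= `|g y|) ->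
  {for x, continuous g} -> {for x, continuous f}.
Proof.
move=> f0 g0 fg /cvgrPdist_le cg; apply/cvgrPdist_le => e e0.
apply: filterS (cg e e0) => y; rewrite f0 g0 !sub0r !normrN.
exact: le_trans.
Qed.

End ContinuousFor.

(** * The Euclidean norm and radial fields *)

Section EuclideanNorm.
Context {R : realType} {N : nat}.
Implicit Types (x y : 'rV[R]_N) (h c : R) (i j : 'I_N).

Lemma enorm_ge0 x : 0 <= enorm x.
Proof. exact: sqrtr_ge0. Qed.

Lemma enorm_sqr x : enorm x ^+ 2 = \sum_i x ord0 i ^+ 2.
Proof. by rewrite sqr_sqrtr // sumr_ge0 // => i _; rewrite sqr_ge0. Qed.

Lemma enorm0 : enorm (0 : 'rV[R]_N) = 0.
Proof. by rewrite /enorm big1 ?sqrtr0 // => i _; rewrite mxE expr0n. Qed.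

Lemma coord_le_enorm x i : `|x ord0 i| <= enorm x.
Proof.
rewrite -sqrtr_sqr ler_wsqrtr // (bigD1 i) //= lerDl.
by rewrite sumr_ge0 // => j _; rewrite sqr_ge0.
Qed.

Lemma enorm_eq0 x : enorm x = 0 -> x = 0.
Proof.
move=> x0; apply/rowP => i; rewrite mxE; apply/eqP; rewrite -normr_le0.
by rewrite -x0 coord_le_enorm.
Qed.

Lemma enorm_gt0 x : x != 0 -> 0 < enorm x.
Proof.
move=> x0; rewrite lt_neqAle enorm_ge0 andbT eq_sym; apply: contra_neq x0.
exact: enorm_eq0.
Qed.

Lemma enorm_continuous : continuous (@enorm R N).
Proof.
move=> x; apply: (@continuous_for_comp _ _ (fun y : 'rV[R]_N => \sum_i y ord0 i ^+ 2));
  last exact: sqrt_continuous.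
apply: (continuous_big (@add_continuous R)) => i _ y.
apply: (@continuous_for_comp _ _ (fun y : 'rV[R]_N => y ord0 i) (fun t : R => t ^+ 2)).
  exact: coord_continuous.
exact: exprn_continuous.
Qed.

Lemma continuous_radial (h : R -> R) : continuous h ->
  continuous (fun x : 'rV[R]_N => h (enorm x)).
Proof.
by move=> ch x; apply: continuous_for_comp; [exact: enorm_continuous|exact: ch].
Qed.

Lemma enorm_scale_sqr c x : enorm (c *: x) ^+ 2 = c ^+ 2 * enorm x ^+ 2.
Proof.
by rewrite !enorm_sqr mulr_sumr; apply: eq_bigr => i _; rewrite mxE exprMn.
Qed.

Lemma coord_line x h i j :
  (h *: basis_vec j + x) ord0 i = h * (i == j)%:R + x ord0 i.
Proof. by rewrite !mxE eqxx /= eq_sym. Qed.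

Lemma enorm_line x h j :
  enorm (h *: basis_vec j + x) = Num.sqrt (enorm x ^+ 2 + (2 * x ord0 j * h + h ^+ 2)).
Proof.
congr Num.sqrt; rewrite enorm_sqr (bigD1 j) //= [in RHS](bigD1 j) //= coord_line eqxx mulr1.
rewrite (eq_bigr (fun i => x ord0 i ^+ 2)) => [|i /negbTE ij]; first by ring.
by rewrite coord_line ij mulr0 add0r.
Qed.

Lemma enorm_basis h j : enorm (h *: basis_vec j) = `|h|.
Proof. by rewrite -[_ *: _]addr0 enorm_line enorm0 mxE expr0n add0r mulr0 mul0r add0r sqrtr_sqr. Qed.

(** Along a coordinate line the squared norm is a polynomial in the parameter, positive at [x != 0],
    where the square root is differentiable. *)
Lemma is_derive_radial (f : R -> R) (d : R) x j : x != 0 ->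
  is_derive (enorm x) (1 : R) f d ->
  is_derive x (basis_vec j) (fun y => f (enorm y)) (d * (x ord0 j / enorm x)).
Proof.
move=> x0 hf; have e0 := enorm_gt0 x0; apply: is_derive_line.
pose p h := enorm x ^+ 2 + (2 * x ord0 j * h + h ^+ 2).
have p0 : p 0 = enorm x ^+ 2 by rewrite /p mulr0 expr0n !addr0.
have dp : is_derive (0 : R) (1 : R) p (2 * x ord0 j).
  apply: (is_derive_val (is_derive_add (is_derive_const _ _) (is_derive_add
    (is_derive_scale (f := id) _ (is_derive_id _ _)) (is_derive_pow _ 2)))).
  by rewrite expr1; ring.
have p0' : 0 < p 0 by rewrite p0 exprn_gt0.
have ds := is_derive_comp1 (f := Num.sqrt) (is_derive1_sqrt p0') dp.
have sp0 : Num.sqrt (p 0) = enorm x by rewrite p0 sqrtr_sqr ger0_norm // ltW.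
have hf' : is_derive (Num.sqrt (p 0)) (1 : R) f d by rewrite sp0.
rewrite (_ : (fun h => _) = (fun h => f (Num.sqrt (p h)))); last first.
  by apply/funext => h; rewrite enorm_line.
apply: (is_derive_val (is_derive_comp1 (f := f) (g := fun h => Num.sqrt (p h)) hf' ds)).
by rewrite sp0; field; rewrite gt_eqF.
Qed.

(* [D r] stands for [r f'(r)]; the formula for the derivative is also correct at [x = 0],
   where the quotient is [0 / 0 = 0]. *)
Lemma is_derive_radial_field (f D : R -> R) x i j : continuous f ->
  (forall r : R, 0 < r -> is_derive r (1 : R) f (D r / r)) ->
  is_derive x (basis_vec j) (fun y => y ord0 i * f (enorm y))
    ((i == j)%:R * f (enorm x) + x ord0 i * x ord0 j * D (enorm x) / enorm x ^+ 2).
Proof.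
move=> cf hf; apply: is_derive_line; have [->|x0] := eqVneq x 0.
  rewrite enorm0 !mxE !mul0r addr0.
  apply: is_derive_of_cvg.
  (* On a coordinate line through the origin the difference quotient is exactly
     [(i == j) * f |h|]. *)
  have : (i == j)%:R * f `|h| @[h --> (0:R)^'] --> (i == j)%:R * f `|0 : R|.
    have c1 : {for 0, continuous (fun h : R => (i == j)%:R * f `|h|)}.
      apply: continuous_for_mul; first exact: continuous_for_cst.
      by apply: continuous_for_comp; [exact: norm_continuous|exact: cf].
    by apply: cvg_trans c1; apply: cvg_app; exact: cvg_within.
  rewrite normr0.
  apply: cvg_trans; apply: near_eq_cvg; near=> h.
  have h0 : h != 0 by near: h; exact: nbhs_dnbhs_neq.
  rewrite !coord_line mxE !addr0 mul0r mul0r subr0 /GRing.scale /= mulr1 enorm_basis.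
  by field.
have e0 := enorm_gt0 x0.
have dr := cvg_of_is_derive (is_derive_radial j x0 (hf _ e0)).
have dr' : is_derive (0 : R) (1 : R) (fun h => f (enorm (h *: basis_vec j + x)))
    (D (enorm x) / enorm x * (x ord0 j / enorm x)).
  apply: is_derive_of_cvg; apply: cvg_trans dr; apply: near_eq_cvg; near=> h.
  by rewrite scale0r add0r addr0 /GRing.scale /= mulr1.
rewrite (_ : (fun h => _) =
  (fun h => ((i == j)%:R * h + x ord0 i) * f (enorm (h *: basis_vec j + x)))); last first.
  by apply/funext => h; rewrite coord_line mulrC [_ * h]mulrC mulrC.
apply: (is_derive_val (is_derive_mul (is_derive_add
  (is_derive_scale (f := id) _ (is_derive_id _ _)) (is_derive_const _ _)) dr')).
by rewrite scale0r add0r mulr0 add0r; field; rewrite gt_eqF.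
Unshelve. all: by end_near. Qed.

(** At the origin the factor [x_i x_j / |x|^2] has no limit but is at most 1 in absolute value, so
    [D 0 = 0] suffices. *)
Lemma radial_field_derivative_continuous (f D : R -> R) i j :
  continuous f -> continuous D -> D 0 = 0 ->
  continuous (fun x => (i == j)%:R * f (enorm x) +
    x ord0 i * x ord0 j * D (enorm x) / enorm x ^+ 2).
Proof.
move=> cf cD D0; apply: continuous_of_for => x; apply: continuous_for_add.
  by apply: continuous_for_mul; [exact: continuous_for_cst|exact: continuous_radial].
have [x0|x0] := eqVneq x 0; last first.
  apply: continuous_for_mul; last first.
    apply: continuous_for_inv; first by rewrite expf_neq0 // gt_eqF // enorm_gt0.
    by apply: (continuous_radial (h := fun r => r ^+ 2)); exact: exprn_continuous.
  apply: continuous_for_mul; last exact: continuous_radial.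
  by apply: continuous_for_mul; exact: coord_continuous.
have cDx : {for x, continuous (fun y => D (enorm y))} by exact: continuous_radial.
apply: continuous_for_dominated cDx => [||y]; rewrite ?x0 ?mxE ?mul0r ?enorm0 //.
have [->|y0] := eqVneq y 0; first by rewrite mxE !mul0r normr0.
have ey := enorm_gt0 y0.
rewrite normrM normfV (ger0_norm (sqr_ge0 _)) ler_pdivrMr ?exprn_gt0 //.
rewrite normrM mulrC ler_wpM2l // normrM expr2.
by rewrite ler_pM // coord_le_enorm.
Unshelve. all: by end_near. Qed.

End EuclideanNorm.

(** * The radial solution *)

Section RadialSolution.
Context {R : realType}.
Variables (n : nat) (g : R -> R) (xi : R) (v q : R -> R).
Hypotheses (cg : continuous g) (P : profile n g xi v q).
Implicit Types (r : R) (x : 'rV[R]_n.+1) (i j : 'I_n.+1).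

Let w r := r * q r.
Let rho r := (Num.sqrt (1 - w r ^+ 2))^-1.

(** [Q r] is [v' r / r], so the gradient of the solution is [Q |x| *: x]. [Dq r] and [DQ r] stand
    for [r q' r] and [r Q' r]; both vanish at 0 by the value of [q 0]. *)
Let Q r := q r * rho r.
Let Dq r := - g (v r) - n.+1%:R * q r.
Let DQ r := rho r ^+ 3 * (- g (v r) - n%:R * q r) - Q r.

Let sqrt_gt0 r : 0 < Num.sqrt (1 - w r ^+ 2).
Proof. by rewrite sqrtr_gt0 one_sub_sqr_gt0 // (profile_w_lt P). Qed.

Lemma slopeE r : slope (w r) = r * Q r.
Proof. by rewrite /slope /Q /rho mulrA. Qed.

Let cq : continuous q. Proof. exact: profile_cq P. Qed.

Let cw : continuous w. Proof. exact: profile_w_continuous P. Qed.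

Let cgv : continuous (fun r => - g (v r)).
Proof.
apply: continuous_of_for => r; apply: continuous_for_opp; apply: continuous_for_comp.
  exact: (profile_cv P).
exact: cg.
Qed.

Let crho : continuous rho.
Proof.
apply: continuous_of_for => r; apply: continuous_for_inv; first by rewrite gt_eqF.
apply: continuous_for_comp; last exact: sqrt_continuous.
apply: (continuous_for_comp (f := w) (h := fun x : R => 1 - x ^+ 2)); first exact: cw.
exact: is_derive_continuous (is_derive_one_sub_sqr _).
Qed.

Let cQ : continuous Q.
Proof. by apply: continuous_of_for => r; apply: continuous_for_mul; [exact: cq|exact: crho]. Qed.

Let cDQ : continuous DQ.
Proof.
apply: continuous_of_for => r; apply: continuous_for_add; last first.
  by apply: continuous_for_opp; exact: cQ.
apply: continuous_for_mul.
  by apply: (continuous_for_comp (f := rho) (h := fun x : R => x ^+ 3)); [exact: crho|exact: exprn_continuous].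
apply: continuous_for_add; first exact: cgv.
apply: continuous_for_opp; apply: continuous_for_mul; first exact: continuous_for_cst.
exact: cq.
Qed.

Let w0 : w 0 = 0. Proof. by rewrite /w mul0r. Qed.

Let rho0 : rho 0 = 1. Proof. by rewrite /rho w0 expr0n subr0 sqrtr1 invr1. Qed.

Let gxi : - g xi = n.+1%:R * q 0. Proof. by rewrite (profile_q0 P). Qed.

Let Dq0 : Dq 0 = 0.
Proof. by rewrite /Dq (profile_v0 P) gxi subrr. Qed.

Let DQ0 : DQ 0 = 0.
Proof. by rewrite /DQ /Q rho0 (profile_v0 P) gxi -natr1; ring. Qed.

Let hdq r : 0 < r -> is_derive r (1 : R) q (Dq r / r).
Proof. by move=> r0; exact: (profile_dq P r0). Qed.

Let hdQ r : 0 < r -> is_derive r (1 : R) Q (DQ r / r).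
Proof.
move=> r0; have rn0 : r != 0 by rewrite gt_eqF.
have h := one_sub_sqr_gt0 (profile_w_lt P r); rewrite -/(w r) in h.
have ds := is_derive_comp1 (f := Num.sqrt) (g := fun t => 1 - w t ^+ 2) (is_derive1_sqrt h)
  (is_derive_comp1 (is_derive_one_sub_sqr (w r)) (profile_dw P r0)).
have sn0 : Num.sqrt (1 - w r ^+ 2) != 0 by rewrite gt_eqF.
apply: (is_derive_val (is_derive_mul (hdq r0) (is_derive_inv (f := fun t => Num.sqrt (1 - w t ^+ 2)) sn0 ds))).
have ss := sqr_sqrtr (ltW h).
rewrite /DQ /Q /rho /Dq; move: ss sn0; rewrite /w; set S := Num.sqrt _ => ss sn0.
(* With [w' = - g v - n q] this reads [S^2 (w' - q) + w^2 w' = w' - S^2 q], a consequence of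
   [S^2 + w^2 = 1]. *)
have e : S ^+ 2 * (- g (v r) - n.+1%:R * q r) +
    (r * q r) * q r * r * (- g (v r) - n%:R * q r) =
    (- g (v r) - n%:R * q r) - S ^+ 2 * q r.
  by rewrite ss -natr1; ring.
apply: (@mulfI _ (S ^+ 3 * r)); first by rewrite mulf_neq0 // expf_neq0.
transitivity (S ^+ 2 * (- g (v r) - n.+1%:R * q r) +
    (r * q r) * q r * r * (- g (v r) - n%:R * q r)).
  by field; rewrite sn0.
by rewrite e; field; rewrite sn0 rn0.
Qed.

Definition radial x : R := v (enorm x).

Lemma is_derive_radial_solution x i :
  is_derive x (basis_vec i) radial (x ord0 i * Q (enorm x)).
Proof.
have [->|x0] := eqVneq x 0.
  rewrite mxE mul0r; apply: is_derive_line.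
  rewrite (_ : (fun h => _) = v); last first.
    apply/funext => h; rewrite addr0 /radial enorm_basis.
    by case: (ger0P h) => _ //; rewrite (profile_v_even P).
  apply: (is_derive_val (is_derive_profile 0 P)).
  by rewrite mul0r /slope mul0r.
apply: (is_derive_eq (is_derive_radial (f := v) i x0 (profile_dv P (enorm_gt0 x0)))).
rewrite -/(w _) slopeE; field; rewrite gt_eqF //; exact: enorm_gt0.
Qed.

Lemma partial_radial i : partial i radial = fun x => x ord0 i * Q (enorm x).
Proof.
by apply/funext => x; rewrite /partial; case: (is_derive_radial_solution x i).
Qed.

Lemma partial2_radial i j : partial j (partial i radial) = fun x =>
  (i == j)%:R * Q (enorm x) + x ord0 i * x ord0 j * DQ (enorm x) / enorm x ^+ 2.
Proof.
rewrite partial_radial; apply/funext => x.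
by rewrite /partial; case: (is_derive_radial_field x i j cQ hdQ).
Qed.

Lemma radial_C2 : C2 radial.
Proof.
split.
- exact: continuous_radial (profile_cv P).
- move=> i; split => [x|].
    by case: (is_derive_radial_solution x i).
  rewrite partial_radial; apply: continuous_of_for => x.
  by apply: continuous_for_mul; [exact: coord_continuous|exact: continuous_radial].
- move=> i j; split => [x|].
    rewrite partial_radial.
    by case: (is_derive_radial_field x i j cQ hdQ).
  rewrite partial2_radial; exact: (radial_field_derivative_continuous cQ cDQ DQ0).
Qed.

(** [v' = w * rho] and [rho^2 = 1 / (1 - w^2)] give [1 + v'^2 = rho^2], so the normalization cancels
    the factor [rho] in [Q]. *)
Lemma radial_flux x : (Num.sqrt (1 + enorm (gradient radial x) ^+ 2))^-1 *: gradient radial x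
  = q (enorm x) *: x.
Proof.
have -> : gradient radial x = Q (enorm x) *: x.
  by apply/rowP => i; rewrite !mxE partial_radial mulrC.
rewrite enorm_scale_sqr scalerA; congr (_ *: _).
set r := enorm x; have h := one_sub_sqr_gt0 (profile_w_lt P r); rewrite -/(w r) in h.
have s0 := sqrt_gt0 r; have ss := sqr_sqrtr (ltW h).
have -> : 1 + Q r ^+ 2 * r ^+ 2 = (rho r) ^+ 2.
  rewrite /Q /rho exprMn exprVn ss; move: h; rewrite /w => h.
  by field; rewrite gt_eqF.
rewrite sqrtr_sqr gtr0_norm ?invr_gt0 // /Q /rho invrK mulrCA divff ?mulr1 //.
by rewrite gt_eqF.
Qed.

(** The divergence of [q |x| *: x] is [(n + 1) q + r q' = (n + 1) q + Dq], which is [- g v] by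
    definition of [Dq]; at the origin only [(n + 1) q 0 = - g xi] remains. *)
Lemma radial_solution : classical_solution g radial.
Proof.
split; first exact: radial_C2.
move=> x; rewrite (_ : (fun y => _) = fun y => q (enorm y) *: y); last first.
  by apply/funext => y; rewrite radial_flux.
have -> : divergence (fun y => q (enorm y) *: y) x =
    \sum_i (q (enorm x) + x ord0 i ^+ 2 * (Dq (enorm x) / enorm x ^+ 2)).
  apply: eq_bigr => i _; rewrite /partial.
  rewrite (_ : (fun y => _) = fun y : 'rV[R]_n.+1 => y ord0 i * q (enorm y)); last first.
    by apply/funext => y; rewrite mxE mulrC.
  case: (is_derive_radial_field x i i cq hdq) => _ ->.
  by rewrite eqxx mul1r -expr2 mulrA.
rewrite big_split /= sumr_const card_ord -mulr_suml -enorm_sqr -mulr_natl.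
have [->|x0] := eqVneq x 0.
  by rewrite enorm0 Dq0 mul0r mulr0 addr0 /radial enorm0 (profile_v0 P) -gxi opprK.
rewrite [enorm x ^+ 2 * _]mulrC divfK; last by rewrite expf_neq0 // gt_eqF // enorm_gt0.
by rewrite /Dq /radial; ring.
Qed.

Lemma radial_le x : `|radial x| <= `|xi|.
Proof. exact: profile_v_le P _. Qed.

Lemma radial0 : radial 0 = xi.
Proof. by rewrite /radial enorm0 (profile_v0 P). Qed.

Lemma radial_oscillating : (forall r0 : R, 0 <= r0 -> exists2 r : R, r0 < r & v r = 0) ->
  oscillating radial.
Proof.
move=> hz; have [z hz'] : {z : nat -> R & forall k, k%:R < z k /\ v (z k) = 0}.
  apply: (@choice _ _ (fun k r => k%:R < r /\ v r = 0)) => k.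
  by have [r rk vr] := hz k%:R (ler0n _ _); exists r.
(* The zeros are placed on the first axis, where the Euclidean norm is [|z k|]; that coordinate also
   bounds the sup norm from below. *)
exists (fun k => z k *: basis_vec ord0); split => [k|].
  have [zk vz] := hz' k; rewrite /radial enorm_basis ger0_norm //.
  by rewrite ltW // (le_lt_trans _ zk).
move=> [M [Mr hM]]; pose k := (Num.truncn (`|M| + 1)).+1.
have [zk _] := hz' k.
have z0 : 0 <= z k by rewrite ltW // (le_lt_trans _ zk).
have M1 : M < `|M| + 1 by rewrite (le_lt_trans (ler_norm _)) // ltrDl.
have := hM _ M1 (z k *: basis_vec ord0); rewrite /= => H.
have {H} : `|z k *: basis_vec ord0 : 'rV[R]_n.+1| <= `|M| + 1 by apply: H; exists k.
have h2 : `|z k| <= `|z k *: basis_vec ord0 : 'rV[R]_n.+1|.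
  rewrite [leRHS]mx_normrE (le_trans _ (le_bigmax _ _ (ord0, ord0))) //=.
  by rewrite !mxE !eqxx mulr1.
move/(le_trans h2); apply/negP; rewrite -ltNge (ger0_norm z0).
by apply: lt_trans zk; exact: truncnS_gt.
Qed.

Let tail (f : R -> R) := f r @[r --> +oo] --> (0 : R).

Lemma vanishes_of_tail (f : R -> R) (u : 'rV[R]_n.+1 -> R) : tail f ->
  (forall x, 1 <= enorm x -> `|u x| <= `|f (enorm x)|) -> vanishes_at_infinity u.
Proof.
move=> /cvgrPdist_lt hf uf e e0.
have [M [_ hM]] := hf e e0; exists (Num.max M 1) => x.
rewrite gt_max => /andP[Mx x1]; apply: (le_lt_trans (uf x (ltW x1))).
by have := hM _ Mx; rewrite /= sub0r normrN.
Qed.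

(** Decay of [v] and [w] is enough: the gradient is bounded by [|w rho|] and the second derivatives
    by [|Q| + |DQ|], and these tend to 0 because [rho] tends to 1 and [g v] to [g 0 = 0]. *)
Lemma radial_localized : g 0 = 0 -> (forall e : R, 0 < e ->
    exists2 r0 : R, 1 <= r0 & forall r, r0 <= r -> `|v r| < e /\ `|r * q r| < e) ->
  localized radial.
Proof.
move=> g0 hd.
have tv : tail v.
  apply/cvgrPdist_lt => e e0; have [r0 _ h] := hd e e0; exists r0; split; first exact: num_real.
  by move=> r /ltW hr; rewrite sub0r normrN; exact: (h r hr).1.
have tw : tail w.
  apply/cvgrPdist_lt => e e0; have [r0 _ h] := hd e e0; exists r0; split; first exact: num_real.
  by move=> r /ltW hr; rewrite sub0r normrN; exact: (h r hr).2.
have tq : tail q.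
  apply/cvgrPdist_lt => e e0; have [r0 r01 h] := hd e e0; exists r0; split; first exact: num_real.
  move=> r /ltW hr; rewrite sub0r normrN; apply: le_lt_trans (h r hr).2.
  have r1 := le_trans r01 hr.
  by rewrite normrM ler_peMl // ger0_norm // (le_trans ler01).
have trho : rho r @[r --> +oo] --> (1 : R).
  have c0 : {for 0, continuous (fun x : R => (Num.sqrt (1 - x ^+ 2))^-1)}.
    apply: continuous_for_inv; first by rewrite expr0n subr0 sqrtr1 oner_neq0.
    apply: continuous_for_comp; last exact: sqrt_continuous.
    exact: is_derive_continuous (is_derive_one_sub_sqr _).
  have := cvg_comp _ _ tw c0; rewrite /= expr0n subr0 sqrtr1 invr1; exact.
have tgv : tail (fun r => - g (v r)).
  have cg0 : {for 0, continuous (fun s => - g s)} by apply: continuous_for_opp; exact: cg.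
  have := cvg_comp _ _ tv cg0; rewrite /= g0 oppr0; exact.
have tQ : tail Q.
  by rewrite /tail -[X in _ --> X](mul0r 1); exact: cvgM tq trho.
have tS : tail (fun r => w r * rho r).
  by rewrite /tail -[X in _ --> X](mul0r 1); exact: cvgM tw trho.
have tDQ : tail DQ.
  rewrite /tail /DQ; have -> : 0 = 1 ^+ 3 * (0 - n%:R * 0) - 0 :> R by ring.
  apply: cvgB tQ; apply: cvgM; last by apply: cvgB tgv _; apply: cvgMr tq.
  exact: cvg_comp trho (@exprn_continuous R 3 1).
split.
- exact: vanishes_of_tail tv _.
- move=> i; rewrite partial_radial; apply: (vanishes_of_tail tS) => x _.
  have -> : w (enorm x) * rho (enorm x) = enorm x * Q (enorm x) by rewrite /w /Q mulrA.
  rewrite normrM [leRHS]normrM ler_wpM2r //.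
  by rewrite (ger0_norm (enorm_ge0 x)) coord_le_enorm.
- move=> i j; rewrite partial2_radial.
  have tN : tail (fun r => `|Q r| + `|DQ r|).
    rewrite /tail -[X in _ --> X]addr0 -(@normr0 _ R).
    by apply: cvgD; exact: cvg_norm.
  apply: (vanishes_of_tail tN) => x x1; have x0 := lt_le_trans ltr01 x1.
  rewrite [leRHS]ger0_norm ?addr_ge0 //; apply: (le_trans (ler_normD _ _)); apply: lerD.
    by rewrite normrM ler_piMl //; case: (i == j); rewrite ?normr1 ?normr0.
  rewrite normrM normfV (ger0_norm (sqr_ge0 _)) ler_pdivrMr ?exprn_gt0 //.
  rewrite normrM mulrC ler_wpM2l // normrM expr2.
  by rewrite ler_pM // coord_le_enorm.
Qed.

End RadialSolution.

(** * Essential supremum *)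

Section OuterMeasure.
Context {R : realType}.
Implicit Types (c d t : R).

(* Induction on the dimension: integrating the hypothesis over the first coordinate replaces an
   indicator function by the length of a side. *)
Lemma weighted_box_cover n (a b : nat -> 'I_n -> R) (c : nat -> R) d :
  0 <= d -> (forall k, 0 <= c k) -> (forall k i, a k i <= b k i) ->
  (forall x : 'I_n -> R, (forall i, 0 <= x i <= d) ->
    (1 <= \sum_(0 <= k <oo) (c k * \prod_i (\1_(`[a k i, b k i]) (x i)))%:E)%E) ->
  ((d ^+ n)%:E <= \sum_(0 <= k <oo) (c k * \prod_i (b k i - a k i))%:E)%E.
Proof.
move=> d0; elim: n a b c => [|n IH] a b c c0 ab cov.
  have := cov (fun=> 0); rewrite expr0.
  under eq_eseriesr do rewrite big_ord0.
  under [in X in _ -> X]eq_eseriesr do rewrite big_ord0.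
  by apply; case.
pose L k := \prod_(i < n) (b k (lift ord0 i) - a k (lift ord0 i)).
have L0 k : 0 <= L k by apply: prodr_ge0 => i _; rewrite subr_ge0.
have slice t : 0 <= t <= d ->
    ((d ^+ n)%:E <= \sum_(0 <= k <oo) (c k * L k * \1_(`[a k ord0, b k ord0]) t)%:E)%E.
  (* Freezing the first coordinate at [t] moves its indicator into the weights. *)
  move=> td; have := IH (fun k i => a k (lift ord0 i)) (fun k i => b k (lift ord0 i))
    (fun k => c k * \1_(`[a k ord0, b k ord0]) t).
  under eq_eseriesr do rewrite mulrAC.
  apply => // [k|x hx]; first by rewrite mulr_ge0.
  have := cov (fun i => if unlift ord0 i is Some j then x j else t).
  under eq_eseriesr => k _.
    rewrite big_ord_recl unlift_none mulrA.
    under eq_bigr do rewrite liftK.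
    over.
  by apply => i; case: (unlift ord0 i).
have mI : measurable (`[0, d]%classic : set R) by exact: measurable_itv.
have mu_I : lebesgue_measure (`[0, d]%classic : set R) = d%:E.
  rewrite lebesgue_measure_itv /= lte_fin; case: ltP => [_|d0']; first by rewrite -EFinB subr0.
  by congr EFin; apply/eqP; rewrite eq_le d0 d0'.
pose F k t : \bar R := ((c k * L k)%:E * (\1_(`[a k ord0, b k ord0]) t)%:E)%E.
have F0 k t : (0 <= F k t)%E by rewrite /F -EFinM lee_fin !mulr_ge0.
have -> : ((d ^+ n.+1)%:E = \int[lebesgue_measure]_(t in `[0%R, d]) cst (d ^+ n)%:E t)%E.
  by rewrite integral_cst //= mu_I -EFinM exprSr.
have le1 : (\int[lebesgue_measure]_(t in `[0%R, d]) cst (d ^+ n)%:E t <=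
    \int[lebesgue_measure]_(t in `[0%R, d]) \sum_(0 <= k <oo) F k t)%E.
  apply: ge0_le_integral => //.
  - by move=> t _; rewrite lee_fin exprn_ge0.
  - by apply: ge0_emeasurable_sum => // k _; apply: measurable_funeM; apply/measurable_EFinP; exact: measurable_indic.
apply: (le_trans le1); rewrite integral_nneseries //; last first.
  by move=> k; apply: measurable_funeM; apply/measurable_EFinP; exact: measurable_indic.
apply: lee_nneseries => [k _ _|k _].
  by apply: integral_ge0 => t _; exact: F0.
rewrite ge0_integralZl_EFin ?mulr_ge0 //; last first.
  by apply/measurable_EFinP; exact: measurable_indic.
rewrite integral_indic //.
have mu_le : (lebesgue_measure (`[a k ord0, b k ord0] `&` `[0%R, d] : set R) <=
    (b k ord0 - a k ord0)%:E)%E.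
  apply: (@le_trans _ _ (lebesgue_measure (`[a k ord0, b k ord0]%classic : set R))).
    by apply: le_measure; rewrite ?inE //; exact: measurableI.
  rewrite lebesgue_measure_itv /= lte_fin; case: ltP => _; first by rewrite -EFinB.
  by rewrite lee_fin subr_ge0.
rewrite big_ord_recl -/(L k) [X in (_ <= (c k * X)%:E)%E]mulrC mulrA EFinM.
by apply: lee_wpmul2l mu_le; rewrite lee_fin mulr_ge0.
Qed.

(** For a cover by boxes the sum of the indicators is at least 1 on the cube, since one box
    containing the point already contributes 1; the weighted estimate is used with unit weights. *)
Lemma cube_outer_measure_ge n (A : set 'rV[R]_n) d : 0 <= d ->
  (forall x : 'rV[R]_n, (forall i, 0 <= x ord0 i <= d) -> A x) ->
  ((d ^+ n)%:E <= lebesgue_outer_measure A)%E.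
Proof.
move=> d0 hA; apply: le_ereal_inf_tmp => _ [a [b [ab cov ->]]].
have := @weighted_box_cover n (fun k i => a k ord0 i) (fun k i => b k ord0 i) (fun=> 1) d d0.
under [X in (_ -> _ -> _ -> _ <= X)%E -> _]eq_eseriesr do rewrite mul1r.
apply => // x hx.
have [k _ xk] : (\bigcup_k box (a k) (b k)) (\row_i x i).
  by apply: cov; apply: hA => i; rewrite mxE.
rewrite (nneseriesD1 (n := k)) //; last by move=> j _; rewrite lee_fin mul1r prodr_ge0.
rewrite mul1r big1 => [|i _]; last first.
  rewrite indicE mem_set //= in_itv /=; have := xk i; by rewrite mxE.
by rewrite leeDl // nneseries_ge0 // => j _ _; rewrite lee_fin mul1r prodr_ge0.
Qed.

(** Covers consist of nonempty boxes, so degenerate ones are used. They have volume 0 in positive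
    dimension, while in dimension 0 the empty product would be 1. *)
Lemma outer_measure_set0 n : lebesgue_outer_measure (set0 : set 'rV[R]_n.+1) = 0%E.
Proof.
apply/eqP; rewrite eq_le; apply/andP; split.
  apply: ereal_inf_lbound; exists (fun=> 0), (fun=> 0); split => //.
  rewrite eseries0 // => k _ _.
  by rewrite /box_volume big_ord_recl subrr mul0r.
apply: le_ereal_inf_tmp => _ [a [b [ab _ ->]]]; apply: nneseries_ge0 => k _ _.
by rewrite lee_fin prodr_ge0 // => i _; rewrite subr_ge0.
Qed.

(** Above the level [|u 0|] the superlevel set is empty. Below it, continuity at 0 puts a cube of
    positive side, hence of positive outer measure, into the superlevel set. *)
Lemma Linfty_norm_max_at0 n (u : 'rV[R]_n.+1 -> R) : continuous u ->
  (forall x, `|u x| <= `|u 0|) -> Linfty_norm u = `|u 0|%:E.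
Proof.
move=> cu umax; apply/eqP; rewrite eq_le; apply/andP; split.
  apply: ereal_inf_lbound; rewrite /= (_ : [set x | _] = set0) ?outer_measure_set0 //.
  by rewrite -subset0 => x /=; rewrite lte_fin ltNge umax.
apply: le_ereal_inf_tmp => M /= hM; rewrite leNgt; apply/negP => ltM.
have [e e0 he] : exists2 e : R, 0 < e & forall x : 'rV[R]_n.+1, (forall i, `|x ord0 i| < e) ->
    (M < `|u x|%:E)%E.
  case: M ltM {hM} => [m| |] //; last by exists 1 => // x _; rewrite ltNyr.
  rewrite lte_fin => mu.
  have cu0 : {for (0 : 'rV[R]_n.+1), continuous (fun x : 'rV[R]_n.+1 => `|u x|)}.
    apply: (@continuous_comp _ _ _ u (fun r : R => `|r|)); first exact: cu.
    exact: norm_continuous.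
  have : nbhs (0 : 'rV[R]_n.+1) [set x | m < `|u x|].
    exact: (@cvgr_gt R _ (nbhs (0 : 'rV[R]_n.+1)) _ (fun x => `|u x|) `|u 0| cu0 m mu).
  move=> /nbhs_ballP[e /= e0 he]; exists e => // x hx; rewrite lte_fin; apply: he.
  by split => // i j; rewrite /ball /= mxE sub0r normrN ord1.
have d0 : 0 <= e / 2 by rewrite divr_ge0 // ltW.
have := cube_outer_measure_ge d0 (A := [set x | (M < `|u x|%:E)%E]).
rewrite hM lee_fin => H; suff : (e / 2) ^+ n.+1 <= 0.
  by rewrite leNgt exprn_gt0 // divr_gt0.
apply: H => x hx; apply: he => i; have /andP[h1 h2] := hx i.
by rewrite ger0_norm //; lra.
Qed.

End OuterMeasure.

(** * Conclusion *)

Section Assembly.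
Context {R : realType}.
Implicit Types (v q : R -> R) (r e : R).

(** Common target of the two dimension regimes and of the three signs of [xi]; for odd [g] it is
    stable under a change of sign of [xi], [v] and [q]. *)
Record global_profile n (g : R -> R) (xi : R) v q : Prop := GlobalProfile {
  global_profile_profile : profile n g xi v q;
  global_profile_zeros : forall r0 : R, 0 <= r0 -> exists2 r : R, r0 < r & v r = 0;
  global_profile_periodic : n = 0 -> exists2 T : R, 0 < T & forall r, v (r + T) = v r;
  global_profile_decay : (0 < n)%N -> forall e : R, 0 < e ->
    exists2 r0 : R, 1 <= r0 & forall r, r0 <= r -> `|v r| < e /\ `|r * q r| < e }.

Lemma global_profile_opp n g xi v q : odd_fun g -> global_profile n g xi v q ->
  global_profile n g (- xi) (fun r => - v r) (fun r => - q r).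
Proof.
move=> og [P Z T D]; split; first exact: profile_opp.
- by move=> r0 /Z[r rr vr]; exists r; rewrite ?vr ?oppr0.
- by move=> /T[t t0 ht]; exists t => // r; rewrite ht.
- move=> n0 e /(D n0)[r0 r01 h]; exists r0 => // r /h[h1 h2].
  by rewrite mulrN !normrN.
Qed.

Lemma global_profile0 n (g : R -> R) : odd_fun g -> global_profile n g 0 (fun=> 0) (fun=> 0).
Proof.
move=> og; have g0 : g 0 = 0 by have := og 0; rewrite oppr0 => e; lra.
split.
- split => //.
  + exact: cst_continuous.
  + exact: cst_continuous.
  + by rewrite g0 mulr0 oppr0.
  + move=> r _; apply: (is_derive_val (is_derive_const _ _)).
    by rewrite /slope mulr0 mul0r.
  + move=> r _; rewrite g0 mulr0 oppr0 addr0.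
    rewrite (_ : (fun t => _) = fun=> 0); first exact: is_derive_const.
    by apply/funext => t; rewrite mulr0.
  + by move=> r; rewrite mulr0 normr0.
- by move=> r0 _; exists (r0 + 1) => //; rewrite ltrDl.
- by move=> _; exists 1.
- by move=> _ e e0; exists 1 => // r _; rewrite mulr0 normr0.
Qed.

Lemma global_profile_pos n (g : R -> R) (xi : R) : continuous g -> odd_fun g -> 0 < xi ->
  (forall s : R, 0 < s <= xi -> 0 < g s) -> primitive g xi < 1 ->
  ((0 < n)%N -> positive_derivative_at_0 g) -> exists v q, global_profile n g xi v q.
Proof.
move=> cg og xi0 gpos G1 hg'; have [v [q P] ] := profile_exists n cg og xi0 gpos G1.
case: n hg' P => [_ P|n hg' P].
  have [T T0 vT] := profile_zero_dim1 xi0 gpos P.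
  have [v' [q' [P' per] ] ] := profile_periodic cg og P T0 vT.
  have T40 : 0 < 4 * T by rewrite mulr_gt0.
  (* The unrolled [v'] is itself a profile, so the same argument gives it a zero, which periodicity
     then repeats. *)
  have [T' T'0 v'T'] := profile_zero_dim1 xi0 gpos P'.
  have zk k : v' (T' + k%:R * (4 * T)) = 0.
    elim: k => [|k IH]; first by rewrite mul0r addr0.
    by rewrite -natr1 mulrDl mul1r addrA per.
  exists v', q'; split => //; last by move=> _; exists (4 * T).
  move=> r0 r00; exists (T' + (Num.truncn (r0 / (4 * T))).+1%:R * (4 * T)) => //.
  by rewrite ltr_wpDl ?(ltW T'0) // -ltr_pdivrMr // truncnS_gt.
have [k k0 gk] := linear_lower_bound cg og xi0 gpos (hg' isT).
have [|M _ gM] := @EVT_max R g 0 xi (ltW xi0).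
  by apply: continuous_subspaceT => x; exact: cg.
have gk' (s : R) : 0 <= s <= `|xi| -> k * s <= g s by rewrite (gtr0_norm xi0); exact: gk.
have gM' (s : R) : 0 <= s <= `|xi| -> g s <= g M.
  by rewrite (gtr0_norm xi0) => hs; apply: gM; rewrite in_itv.
exists v, q; split => //.
- by move=> r0 r00; exact: (profile_zeros_unbounded og P k0 gk' r00).
- by move=> _ e e0; exact: (profile_decay cg og _ k0 gk' gM' P).
Qed.

Lemma global_profile_exists n (g : R -> R) (alpha : \bar R) (xi : R) :
  continuous g -> odd_fun g -> sign_condition g alpha ->
  ((0 < n)%N -> positive_derivative_at_0 g) ->
  (`|xi|%:E < alpha)%E -> primitive g xi < 1 -> exists v q, global_profile n g xi v q.
Proof.
move=> cg og [_ gpos _] hg' hxi G1.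
have pos x : 0 < x -> `|x| = `|xi| -> primitive g x < 1 -> exists v q, global_profile n g x v q.
  move=> x0 ex Gx; apply: global_profile_pos => // s /andP[s0 sx]; apply: gpos => //.
  by apply: le_lt_trans hxi; rewrite lee_fin -ex (gtr0_norm x0).
have [xi0|xi0|->] := ltgtP xi 0; last by exists (fun=> 0), (fun=> 0); exact: global_profile0.
  have [|||v [q P] ] := pos (- xi).
  - by rewrite oppr_gt0.
  - by rewrite normrN.
  - by rewrite primitive_even.
  rewrite -(opprK xi); exists (fun r => - v r), (fun r => - q r).
  exact: global_profile_opp.
exact: pos.
Qed.

Lemma radial_periodic_dim1 v (T : R) : (forall r, v (- r) = v r) -> 0 < T ->
  (forall r, v (r + T) = v r) -> is_periodic (radial v : 'rV[R]_1 -> R).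
Proof.
move=> ev T0 per; have vE (x : 'rV[R]_1) : radial v x = v (x ord0 ord0).
  rewrite /radial /enorm big_ord1 sqrtr_sqr.
  by case: (ger0P (x ord0 ord0)) => _ //; rewrite ev.
exists (const_mx T); last by move=> x; rewrite !vE !mxE per.
by apply/eqP => /rowP/(_ ord0); rewrite !mxE => T00; rewrite T00 ltxx in T0.
Qed.

End Assembly.

Theorem theorem1p2 (R : realType) (N : nat) (hN : (1 <= N)%N)
  (g : R -> R) (alpha : \bar R)
  (g1 : continuous g)
  (g2 : odd_fun g)
  (g3 : sign_condition g alpha)
  (g4 : (2 <= N)%N -> positive_derivative_at_0 g)
  (xi : R) (hxi : (`|xi|%:E < alpha)%E) (hG : primitive g xi < 1) :
  exists u : 'rV[R]_N -> R,
    classical_solution g u /\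
    oscillating u /\
    u 0 = xi /\
    Linfty_norm u = `|xi|%:E /\
    (N = 1%N -> is_periodic u) /\
    ((2 <= N)%N -> localized u).
Proof.
case: N hN g4 => // n _ g4.
have [v [q [P Z T D] ] ] := global_profile_exists (n := n) g1 g2 g3 g4 hxi hG.
have g0 : g 0 = 0 by have := g2 0; rewrite oppr0 => e; lra.
exists (radial v); split; first exact: radial_solution g1 P.
split; first exact: radial_oscillating Z.
have u0 : radial v (0 : 'rV[R]_n.+1) = xi := radial0 P.
split=> //; split.
  rewrite -u0; apply: Linfty_norm_max_at0 => [|x].
    by case: (radial_C2 g1 P).
  by rewrite u0; exact: radial_le P x.
split=> [[n0]|n0].
  by have [t t0 per] := T n0; rewrite n0; exact: radial_periodic_dim1 (profile_v_even P) t0 per.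
exact: radial_localized g1 P g0 (D n0).
Qed.
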